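(* Let $N\in\mathbb{N}$, $s>0$, $I=[a,b]\subset\mathbb{R}_+$, and let $K\subset\mathbb{R}^{N+1}$ be the corresponding set of admissible stock paths. For each $k=0,1,\dots,N$ let $F_k,G_k:K\to\mathbb{R}_+$ be upper semicontinuous functions with $F_k\le G_k$, such that $F_k(u)$ and $G_k(u)$ depend only on $(u_0,\dots,u_k)$ (i.e. $F_k(u)=F_k(v)$ and $G_k(u)=G_k(v)$ whenever $u,v\in K$ and $u_i=v_i$ for all $i\le k$). Let $\mathbb{H}$ be the associated game option payoff and let $\mathbb{V}$ be its super-replication price. Then $$\mathbb V=\inf_{\sigma\in\mathcal{T}}\sup_{\mathbb P\in \mathcal{M}}\sup_{\tau\in\mathcal{T}}\mathbb{E}_{\mathbb P}\mathbb{H}(\sigma,\tau,Z)=\sup_{\mathbb P\in \mathcal{M}}\inf_{\sigma\in\mathcal{T}}\sup_{\tau\in\mathcal{T}}\mathbb{E}_{\mathbb P}\mathbb{H}(\sigma,\tau,Z)=\sup_{\mathbb P\in \mathcal{M}}\sup_{\tau\in\mathcal{T}}\inf_{\sigma\in\mathcal{T}}\mathbb{E}_{\mathbb P}\mathbb{H}(\sigma,\tau,Z).$$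
   Context: $\mathbb{R}_+=[0,\infty)$ and $\mathbb{I}$ denotes an indicator. The set of admissible stock paths is $$K=\{(x_0,\dots,x_N)\in(0,\infty)^{N+1}:\ x_0=s,\ |\ln x_{i+1}-\ln x_i|\in I \text{ for all } i<N\}.$$ The market has a savings account $B\equiv1$ and a stock with price path $S=(S_0,\dots,S_N)\in K$; no probability measure is given. Payoff: $\mathbb{H}(k,l,S)=G_k(S)\mathbb{I}_{k<l}+F_l(S)\mathbb{I}_{l\le k}$ for $k,l\in\{0,\dots,N\}$, $S\in K$ (here $k$ is the seller's cancellation time and $l$ the buyer's exercise time). Portfolio: a pair $\pi=(x,\gamma)$ with initial capital $x\in\mathbb{R}$ and $\gamma:\{0,\dots,N-1\}\times K\to\mathbb{R}$ progressively measurable, i.e. each $\gamma(k,\cdot)$ is Borel measurable and $\gamma(k,u)=\gamma(k,v)$ whenever $u_i=v_i$ for all $i\le k$. Its value is $V^\pi_k(S)=x+\sum_{i=0}^{k-1}\gamma(i,S)(S_{i+1}-S_i)$, $k=0,\dots,N$ (so $V^\pi_0=x$). Stopping time on $K$: a measurable function $\sigma:K\to\{0,\dots,N\}$ such that if $\sigma(u)=k$ then $\sigma(v)=k$ for every $v\in K$ with $v_i=u_i$ for all $i\le k$. Hedge: a pair $(\pi,\sigma)$ of a portfolio and a stopping time on $K$; it is perfect if $V^\pi_{\sigma(S)\wedge l}(S)\ge\mathbb{H}(\sigma(S),l,S)$ for all $S\in K$ and $l=0,\dots,N$. Super-replication price: $\mathbb{V}=\inf\{V^\pi_0:\ \text{there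 exists a stopping time }\sigma\text{ on }K\text{ such that }(\pi,\sigma)\text{ is a perfect hedge}\}$. Let $Z=(Z_0,\dots,Z_N)$ be the canonical process on $\mathbb{R}^{N+1}$, $Z_k(z)=z_k$. A martingale law is a Borel probability measure $\mathbb{P}$ on $\mathbb{R}^{N+1}$ supported on $K$ with $\mathbb{E}_{\mathbb P}(Z_N\mid Z_0,\dots,Z_k)=Z_k$ $\mathbb{P}$-a.s. for every $k<N$; $\mathcal{M}$ is the set of all martingale laws. $\mathcal{T}$ is the set of all stopping times with values in $\{0,\dots,N\}$ with respect to the canonical filtration $\mathcal{F}_k=\sigma(Z_0,\dots,Z_k)$, $k\le N$. *)

(* Defs.v *)
From HB Require Import structures.
From mathcomp Require Import all_boot all_order all_algebra.
From mathcomp Require Import all_classical all_reals all_analysis.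
Set Implicit Arguments.
Unset Strict Implicit.
Unset Printing Implicit Defensive.
Import Order.TTheory GRing.Theory Num.Theory.
Import numFieldNormedType.Exports.
Local Open Scope classical_set_scope.
Local Open Scope ring_scope.

(* Functions whose mathematical domain is [K] (payoffs, trading strategies,
   stopping times on [K]) are total functions on R^{N+1} here; every condition
   and every use restricts them to [K], so their values off [K] are
   irrelevant. *)

(* R^{N+1}, with the product topology (that of the max norm) ... *)
Notation price_path R N := 'rV[R]_(N.+1).

(* ... and the same type equipped with its Borel sigma-algebra. *)
Notation borel_path R N := (g_sigma_algebraType (@open 'rV[R]_(N.+1))).

Section game_option.
Context {R : realType} {N : nat}.
Implicit Types (s : R) (I : set R) (K : set (price_path R N)).
Implicit Types (F G : 'I_N.+1 -> price_path R N -> R).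

(* [inord] makes the index a plain nat; only indices [k <= N] are used. *)
Definition canonical_process (k : nat) (z : borel_path R N) : R :=
  z ord0 (inord k).

Definition admissible_paths s I : set (price_path R N) :=
  [set x : price_path R N |
    [/\ forall i : 'I_N.+1, 0 < x ord0 i,
        canonical_process 0 x = s &
        forall i, (i < N)%N ->
          I `|ln (canonical_process i.+1 x) - ln (canonical_process i x)| ] ].

Definition agree_upto (k : nat) (u v : price_path R N) : Prop :=
  forall i, (i <= k)%N -> canonical_process i u = canonical_process i v.

Definition nonanticipative_on T K (k : nat) (f : price_path R N -> T) : Prop :=
  forall u v, K u -> K v -> agree_upto k u v -> f u = f v.

(* Upper semicontinuity of the restriction of [f] to the subspace [K]. *)
Definition upper_semicontinuous_on K (f : price_path R N -> R) : Prop :=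
  forall x, K x -> forall c, f x < c ->
    \forall y \near within K (nbhs x), f y < c.

Definition game_payoff F G (k l : 'I_N.+1) (S : price_path R N) : R :=
  G k S * (k < l)%N%:R + F l S * (l <= k)%N%:R.

Definition trading_strategy K (g : 'I_N -> price_path R N -> R) : Prop :=
  forall k : 'I_N, measurable_fun (K : set (borel_path R N)) (g k) /\
                   nonanticipative_on K k (g k).

Definition portfolio_value (x : R) (g : 'I_N -> price_path R N -> R) (k : nat)
    (S : price_path R N) : R :=
  x + \sum_(i < N | (i < k)%N)
        g i S * (canonical_process i.+1 S - canonical_process i S).

Definition stopping_time_on K (sigma : price_path R N -> 'I_N.+1) : Prop :=
  measurable_fun (K : set (borel_path R N)) (fun S => sigma S : nat) /\
  forall (k : 'I_N.+1) u v, K u -> K v -> sigma u = k -> agree_upto k u v ->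
    sigma v = k.

Definition perfect_hedge K F G (x : R) (g : 'I_N -> price_path R N -> R)
    (sigma : price_path R N -> 'I_N.+1) : Prop :=
  forall S, K S -> forall l : 'I_N.+1,
    game_payoff F G (sigma S) l S <= portfolio_value x g (minn (sigma S) l) S.

Definition superreplication_price K F G : \bar R :=
  ereal_inf [set x%:E | x in [set x : R |
    exists g sigma, [/\ trading_strategy K g, stopping_time_on K sigma &
                        perfect_hedge K F G x g sigma] ] ].

Definition canonical_filtration (k : nat) : set (set (borel_path R N)) :=
  g_sigma_preimage (fun i : 'I_k.+1 => canonical_process i).

Definition stopping_times : set (borel_path R N -> 'I_N.+1) :=
  [set tau | forall k : 'I_N.+1,
     canonical_filtration k [set z | (tau z <= k)%N] ].

End game_option.

(* [Y] is a version of the conditional expectation E_P(X | A), i.e.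
   Y = E_P(X | A) P-almost surely with [Y] itself [A]-measurable; [A] is meant
   to be a sub-sigma-algebra of the measurable sets. *)
Definition is_cond_expectation d (T : measurableType d) (R : realType)
    (P : probability T R) (A : set (set T)) (X Y : T -> R) : Prop :=
  [/\ P.-integrable setT (EFin \o X),
      P.-integrable setT (EFin \o Y),
      forall B : set R, measurable B -> A (Y @^-1` B) &
      forall E : set T, A E ->
        (\int[P]_(w in E) (Y w)%:E = \int[P]_(w in E) (X w)%:E)%E].

Section dynkin_game.
Context {R : realType} {N : nat}.
Implicit Types (K : set (price_path R N)).
Implicit Types (F G : 'I_N.+1 -> price_path R N -> R).

(* [K] is closed, so "supported on K" amounts to full mass on [K]. *)
Definition martingale_laws K : set (probability (borel_path R N) R) :=
  [set P : probability (borel_path R N) R | P K = 1%E /\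
     forall k, (k < N)%N ->
       is_cond_expectation P (canonical_filtration k)
         (canonical_process N) (canonical_process k)].

(* E_P H(sigma, tau, Z): the integral over [K] is the whole expectation, since
   P(K) = 1, and [F], [G] are meaningful on [K] only. *)
Definition expected_payoff K F G (P : probability (borel_path R N) R)
    (sigma tau : borel_path R N -> 'I_N.+1) : \bar R :=
  (\int[P]_(z in K) (game_payoff F G (sigma z) (tau z) z)%:E)%E.

End dynkin_game.

(* Main.v *)
Require Import Defs.
From HB Require Import structures.
From mathcomp Require Import all_boot all_order all_algebra.
From mathcomp Require Import all_classical all_reals all_analysis.
From mathcomp Require Import measurable_realfun ring lra.
Set Implicit Arguments.
Unset Strict Implicit.
Unset Printing Implicit Defensive.
Import Order.TTheory GRing.Theory Num.Theory.
Import numFieldNormedType.Exports.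
Local Open Scope classical_set_scope.
Local Open Scope ring_scope.

(** Let [U_N = F_N] and [U_k = min (G_k, max (F_k, A_k U_{k+1}))], where [A_k U]
    is the least capital at time [k] from which some stock position
    super-replicates [U] one step later.  All four quantities equal [U_0].
    - A hedge starting below [U_0] fails on some path: as long as the portfolio
      is worth less than [U_k], an admissible next move keeps it below
      [U_{k+1}], and stopping there violates the hedge.
    - Conversely, trading rational near-optimal positions up to the first time
      at which [G_k <= U_k] is a perfect hedge from capital [U_0 + e], and its
      gains integrate to zero under every martingale law.
    - By duality on the line, [A_k U] is approached by two-point martingale
      steps.  Gluing these steps gives a finitely supported martingale law under
      which the buyer, exercising at the first time at which [U_k <= F_k],
      secures [U_0 - e] against every cancellation time. *)

(** Three obstacles shape the argument. Optimality: equality of the values only needs strategies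
    that are optimal up to [e], and this slack allows rational positions. Measurability: compactness
    of [K] keeps suprema over cylinders upper semicontinuous, and infima over positions preserve
    this, so every [U_k] is Borel on [K]; a Borel nonanticipative condition on [K] then becomes an
    event of the canonical filtration by extending each prefix to a whole path of [K].
    Integrability: the positions carry no bound, but their one-step gains do. The recurring tool is
    the symmetry of the constraint: inverting a move gives an admissible move of the opposite sign.
    It excludes arbitrage, so [A_k U] is nonnegative for nonnegative [U]; it bounds the slopes in
    the duality argument; and it bounds the gain of a near-optimal position from both sides. *)

Local Notation Z := canonical_process.

(** * Admissible paths *)

Section price_paths.
Context {R : realType} {N : nat}.
Implicit Types (s a b : R) (x y z u v : price_path R N).

Definition path_of (f : nat -> R) : price_path R N := \row_(i < N.+1) f i.

Lemma path_ofE (f : nat -> R) i : (i <= N)%N -> Z i (path_of f) = f i.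
Proof. by move=> iN; rewrite /canonical_process mxE inordK. Qed.

Lemma canonical_process_continuous i : continuous (Z i : price_path R N -> R).
Proof. exact: coord_continuous. Qed.

Lemma agree_sym k x y : agree_upto k x y -> agree_upto k y x.
Proof. by move=> xy i ik; rewrite xy. Qed.

Lemma agree_trans k x y z : agree_upto k x y -> agree_upto k y z -> agree_upto k x z.
Proof. by move=> xy yz i ik; rewrite xy ?yz. Qed.

Lemma agree_le k l x y : (k <= l)%N -> agree_upto l x y -> agree_upto k x y.
Proof. by move=> kl xy i ik; rewrite xy// (leq_trans ik). Qed.

(** An up-move or a down-move; symmetric in [p] and [q], which is why inverted moves stay
    admissible. *)
Definition ratio_rel (A B p q : R) : Prop :=
  (A * p <= q) /\ (q <= B * p) \/ (A * q <= p) /\ (p <= B * q).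

Lemma ratio_rel_ln a b (p q : R) : 0 <= a -> 0 < p -> 0 < q ->
  (`[a, b]%classic `|ln q - ln p|) <-> ratio_rel (expR a) (expR b) p q.
Proof.
move=> a0 p0 q0; rewrite -(lnK p0) -(lnK q0) !expRK; move: (ln p) (ln q) => t r.
rewrite /ratio_rel -!expRD !ler_expR /= in_itv /=; split.
  move=> /andP[]; have [h|h] := leP 0 (r - t).
    by rewrite ger0_norm// => *; left; lra.
  by rewrite ltr0_norm// => *; right; lra.
move=> [[h1 h2]|[h1 h2]].
  by rewrite ger0_norm; [apply/andP; lra|lra].
by rewrite ler0_norm; [apply/andP; lra|lra].
Qed.

(* Closed, logarithm-free form of the constraints that define [K]. *)
Lemma admissible_pathsP s a b x : 0 < s -> 0 <= a -> admissible_paths s `[a, b]%classic x <->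
  Z 0 x = s /\ forall i, (i < N)%N -> ratio_rel (expR a) (expR b) (Z i x) (Z i.+1 x).
Proof.
move=> s0 a0; split=> [[pos x0 H]|[x0 H]].
  by split=> // i iN; apply/ratio_rel_ln => //; [exact: pos|exact: pos|exact: H].
have pos i : (i <= N)%N -> 0 < Z i x.
  elim: i => [|i ih] iN; first by rewrite x0.
  have zi := ih (ltnW iN); have ea := expR_gt0 a; have eb := expR_gt0 b.
  case: (H i iN) => [[h1 h2]|[h1 h2]].
    by apply: lt_le_trans h1; rewrite mulr_gt0.
  by rewrite -(pmulr_rgt0 _ eb); apply: lt_le_trans h2.
split=> //.
  by move=> i; have := pos i (leq_ord i); rewrite /canonical_process inord_val.
by move=> i iN; apply/ratio_rel_ln => //; [apply: pos; exact: ltnW|exact: pos|exact: H].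
Qed.

Lemma closed_le_fun (T : topologicalType) (f g : T -> R) :
  continuous f -> continuous g -> closed [set x | f x <= g x].
Proof.
move=> cf cg; rewrite (_ : [set x | _] = (g \- f) @^-1` [set r | 0 <= r]).
  apply: closed_comp; last exact: closed_ge.
  by move=> x _; apply: cvgB; [exact: cg|exact: cf].
by apply/seteqP; split=> x /=; rewrite subr_ge0.
Qed.

(** The logarithm-free form is one equation and non-strict inequalities between continuous
    functions; strict positivity, not a closed condition, is recovered from [s > 0] and the ratio
    bounds. *)
Lemma closed_admissible_paths s a b : 0 < s -> 0 <= a ->
  closed (admissible_paths s `[a, b]%classic : set (price_path R N)).
Proof.
move=> s0 a0.
have cZ i : continuous (Z i : price_path R N -> R) by exact: canonical_process_continuous.
have cM c i : continuous (fun x => c * Z i x : R).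
  by move=> x; apply: continuousM; [exact: cst_continuous|exact: cZ].
rewrite (_ : admissible_paths _ _ = [set x | Z 0 x = s] `&`
    \bigcap_(i in [set i | (i < N)%N])
      (([set x | expR a * Z i x <= Z i.+1 x] `&` [set x | Z i.+1 x <= expR b * Z i x]) `|`
       ([set x | expR a * Z i.+1 x <= Z i x] `&` [set x | Z i x <= expR b * Z i.+1 x]))).
  apply: closedI.
    apply: (@closed_comp _ _ (Z 0) [set r | r = s]); last exact: closed_eq.
    by move=> x _; exact: cZ.
  apply: closed_bigI => i _; apply: closedU; apply: closedI; exact: closed_le_fun.
by apply/seteqP; split=> x /(admissible_pathsP _ _ s0 a0).
Qed.

Lemma admissible_paths_le s a b x i : 0 < s -> 0 <= a -> a <= b ->
  admissible_paths s `[a, b]%classic x -> (i <= N)%N -> Z i x <= s * expR b ^+ i.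
Proof.
move=> s0 a0 ab Kx; have [_ _ _] := Kx; have [pos _ _] := Kx.
have /(admissible_pathsP _ _ s0 a0)[x0 H] := Kx.
have a1 : 1 <= expR a by rewrite -expR0 ler_expR.
have b1 : 1 <= expR b by rewrite -expR0 ler_expR (le_trans a0).
elim: i => [|i ih] iN; first by rewrite x0 expr0 mulr1.
have {}ih := ih (ltnW iN).
have zi : 0 < Z i x by exact: pos.
have zi1 : 0 < Z i.+1 x by exact: pos.
have : Z i.+1 x <= expR b * Z i x.
  case: (H i iN) => [[h1 h2]//|[h1 h2]]; nra.
move=> h; apply: le_trans h _.
by rewrite exprS mulrCA ler_wpM2l // expR_ge0.
Qed.

Lemma compact_admissible_paths s a b : 0 < s -> 0 <= a -> a <= b ->
  compact (admissible_paths s `[a, b]%classic : set (price_path R N)).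
Proof.
move=> s0 a0 ab; apply: bounded_closed_compact; last exact: closed_admissible_paths.
have b1 : 1 <= expR b by rewrite -expR0 ler_expR (le_trans a0).
have M0 : 0 <= s * expR b ^+ N by rewrite mulr_ge0 ?exprn_ge0 ?expR_ge0// ltW.
exists (s * expR b ^+ N); split; first exact: num_real.
move=> M MM x Kx; rewrite /Num.Def.normr /= mx_normrE; apply/bigmax_leP; split=> /=.
  by rewrite (le_trans M0)// ltW.
move=> [i j] _ /=; rewrite (ord1 i); have [pos _ _] := Kx.
rewrite gtr0_norm//; apply/ltW/(le_lt_trans _ MM).
have := admissible_paths_le s0 a0 ab Kx (leq_ord j).
rewrite /canonical_process inord_val => /le_trans; apply.
by rewrite ler_pM2l// ler_weXn2l// -ltnS.
Qed.

(* [z] with its move from time [k] to [k+1] inverted; later moves are kept. *)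
Definition flip k z : price_path R N :=
  path_of (fun i => if (i <= k)%N then Z i z else Z i z * (Z k z / Z k.+1 z) ^+ 2).

(** Freezing the price after [k] would leave [K] when [a > 0], so the path goes on with the smallest
    up-moves. It depends on the prefix up to [k] only. *)
Definition stop_extend a k z : price_path R N :=
  path_of (fun i => if (i <= k)%N then Z i z else Z k z * expR a ^+ (i - k)).

Lemma ratio_relM (A B p q c : R) : 0 < c -> ratio_rel A B p q -> ratio_rel A B (p * c) (q * c).
Proof. by move=> c0; rewrite /ratio_rel !mulrA !ler_pM2r. Qed.

Section admissible.
Variables (s a b : R).
Hypotheses (s_gt0 : 0 < s) (a_ge0 : 0 <= a) (a_le_b : a <= b).
Let K : set (price_path R N) := admissible_paths s `[a, b]%classic.

Lemma admissible_gt0 x i : K x -> 0 < Z i x.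
Proof. by move=> [pos _ _]; exact: pos. Qed.

Lemma agree0 x y : K x -> K y -> agree_upto 0 x y.
Proof. by move=> [_ x0 _] [_ y0 _] i; rewrite leqn0 => /eqP ->; rewrite x0 y0. Qed.

Lemma flip_agree k z : (k <= N)%N -> agree_upto k z (flip k z).
Proof. by move=> kN i ik; rewrite path_ofE ?ik// (leq_trans ik). Qed.

(** The moves after [k.+1] are all rescaled by one factor, which [ratio_rel] tolerates. The inverted
    move is the pair [(Z k.+1 z, Z k z)] scaled by [Z k z / Z k.+1 z]. *)
Lemma flip_admissible k z : K z -> (k < N)%N -> K (flip k z).
Proof.
move=> Kz kN; have pos i := admissible_gt0 i Kz.
have /(admissible_pathsP _ _ s_gt0 a_ge0)[z0 H] := Kz.
apply/admissible_pathsP => //; split=> [|i iN].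
  by rewrite -flip_agree// ltnW.
rewrite !path_ofE//; last exact: ltnW.
have [ik|ki|->] := ltngtP i k; [exact: H| | ].
- by apply: ratio_relM; [rewrite exprn_gt0 ?divr_gt0|exact: H].
- rewrite expr2 (_ : _ * (_ * _) = Z k z * (Z k z / Z k.+1 z)).
    have : ratio_rel (expR a) (expR b) (Z k.+1 z) (Z k z).
      by case: (H k kN); [right|left].
    move=> /(@ratio_relM _ _ _ _ (Z k z / Z k.+1 z)).
    by rewrite [Z k.+1 z * _]mulrC divfK ?gt_eqF//; apply; rewrite divr_gt0.
  by field; rewrite gt_eqF.
Qed.

Lemma flipE k z : K z -> (k < N)%N -> Z k.+1 (flip k z) = Z k z ^+ 2 / Z k.+1 z.
Proof.
by move=> Kz kN; rewrite path_ofE// ltnn; field; rewrite gt_eqF// admissible_gt0.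
Qed.

Lemma ratio_relR (p : R) : 0 < p -> ratio_rel (expR a) (expR b) p (p * expR a).
Proof. by move=> p0; left; rewrite mulrC lexx [expR b * _]mulrC ler_pM2l// ler_expR. Qed.

Lemma stop_extend_agree k z : (k <= N)%N -> agree_upto k z (stop_extend a k z).
Proof. by move=> kN i ik; rewrite path_ofE ?ik// (leq_trans ik). Qed.

Lemma stop_extend_admissible k z : K z -> (k <= N)%N -> K (stop_extend a k z).
Proof.
move=> Kz kN; have pos i := admissible_gt0 i Kz.
have /(admissible_pathsP _ _ s_gt0 a_ge0)[z0 H] := Kz.
apply/admissible_pathsP => //; split=> [|i iN].
  by rewrite -stop_extend_agree.
rewrite !path_ofE//; last exact: ltnW.
have [ik|ki|->] := ltngtP i k; [exact: H| | ].
- rewrite subSn ?(ltnW ki)// exprSr mulrA; apply: ratio_relR.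
  by rewrite mulr_gt0// exprn_gt0// expR_gt0.
- by rewrite subSn// subnn expr1; exact: ratio_relR.
Qed.

Lemma admissible_nonempty : K (path_of (fun i => s * expR a ^+ i)).
Proof.
apply/admissible_pathsP => //; split=> [|i iN]; first by rewrite path_ofE// expr0 mulr1.
rewrite !path_ofE//; last exact: ltnW.
have p0 : 0 < s * expR a ^+ i by rewrite mulr_gt0// exprn_gt0// expR_gt0.
by rewrite exprSr mulrA; exact: ratio_relR.
Qed.

End admissible.
End price_paths.

(** * Upper semicontinuous functions on a compact set of paths *)

Section upper_semicontinuity.
Context {R : realType} {N : nat}.
Implicit Types (K : set (price_path R N)) (f g : price_path R N -> R).

Lemma usc_max K f g : upper_semicontinuous_on K f -> upper_semicontinuous_on K g ->
  upper_semicontinuous_on K (fun x => Num.max (f x) (g x)).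
Proof.
move=> uf ug x Kx c; rewrite gt_max => /andP[fc gc].
near=> y; rewrite gt_max; apply/andP; split; near: y; [exact: uf|exact: ug].
Unshelve. all: by end_near. Qed.

Lemma usc_min K f g : upper_semicontinuous_on K f -> upper_semicontinuous_on K g ->
  upper_semicontinuous_on K (fun x => Num.min (f x) (g x)).
Proof.
move=> uf ug x Kx c; rewrite gt_min => /orP[fc|gc]; near=> y; rewrite gt_min; apply/orP; [left|right].
  by near: y; exact: uf.
by near: y; exact: ug.
Unshelve. all: by end_near. Qed.

(** An index that is good enough at [x] stays so nearby. The common lower bound makes the real [inf]
    a genuine infimum. *)
Lemma usc_inf K (I : Type) (h : I -> price_path R N -> R) :
  I -> (forall i x, K x -> 0 <= h i x) -> (forall i, upper_semicontinuous_on K (h i)) ->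
  upper_semicontinuous_on K (fun x => inf (range (h ^~ x))).
Proof.
move=> i0 h0 uh x Kx c /inf_lt[|_ [i _ <-] hc]; first by exists (h i0 x), i0.
have : \forall y \near within K (nbhs x), h i y < c := uh i x Kx c hc.
move=> hyc; near=> y; have Ky : K y by near: y; exact: withinT.
have yc : h i y < c by near: y.
apply: le_lt_trans yc.
by apply: ge_inf; [exists 0 => _ [j _ <-]; exact: h0|exists i].
Unshelve. all: by end_near. Qed.

Lemma usc_addr_continuous K f g : upper_semicontinuous_on K f -> continuous g ->
  upper_semicontinuous_on K (fun x => f x + g x).
Proof.
move=> uf cg x Kx c fgc.
pose e := (c - (f x + g x)) / 2; have e0 : 0 < e by rewrite divr_gt0// subr_gt0.
have fe : f x < f x + e by rewrite ltrDl.
have gxe : g x < g x + e by rewrite ltrDl.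
have ge : \forall y \near within K (nbhs x), g y < g x + e.
  by apply: cvg_within; exact: (cg x _ (lt_nbhsl gxe)).
near=> y; have fy : f y < f x + e by near: y; exact: uf.
have gy : g y < g x + e by near: y.
by move: fy gy; rewrite /e; lra.
Unshelve. all: by end_near. Qed.

Lemma usc_bounded_above K f : compact K -> upper_semicontinuous_on K f ->
  exists M, forall x, K x -> f x <= M.
Proof.
move=> /compact_near_coveringP cK uf.
have := cK nat \oo (fun n x => K x -> f x < n%:R) _.
case=> [x Kx|n _ /(_ n (leqnn n)) H]; last by exists n%:R => x Kx; exact/ltW/H.
have [n fn] : exists n : nat, f x < n%:R.
  by exists (Num.truncn `|f x|).+1; rewrite (le_lt_trans (ler_norm _))// truncnS_gt.
exists ([set y | K y -> f y < n%:R], [set m | (n <= m)%N]).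
  by split; [exact: uf|exists n].
move=> [y m] /= [fy nm] Ky; apply: lt_le_trans (fy Ky) _.
by rewrite ler_nat.
Qed.

Lemma usc_measurable K f : measurable (K : set (borel_path R N)) ->
  upper_semicontinuous_on K f -> measurable_fun (K : set (borel_path R N)) f.
Proof.
move=> mK uf; apply: (measurability _ (RGenInftyO.measurableE R)) => // _ [_ [c ->] <-].
(* An open set of the whole space whose trace on [K] is the sublevel set. *)
pose O := (interior [set y : price_path R N | K y -> f y < c]).
rewrite (_ : _ `&` _ = (K : set (borel_path R N)) `&` (O : set (borel_path R N))).
  by apply: measurableI => //; apply: sub_sigma_algebra; exact: open_interior.
apply/seteqP; split=> x /= [Kx].
  by rewrite in_itv /= => fc; split=> //; exact: uf.
by move=> /interior_subset /(_ Kx); rewrite in_itv.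
Qed.

Definition cylinder K k x := [set z | K z /\ agree_upto k x z].

Lemma cylinder_agree K k x y : agree_upto k x y -> cylinder K k x = cylinder K k y.
Proof.
move=> xy; apply/seteqP; split=> z [Kz h]; split=> //.
  exact: agree_trans (agree_sym xy) h.
exact: agree_trans xy h.
Qed.

(** Compactness forbids cylinders of nearby points to reach far from the cylinder of [x]: each [z]
    in [K] either lies in that cylinder, where semicontinuity applies, or is separated from it by a
    coordinate up to [k]. *)
Lemma usc_sup_cylinder K k f : compact K -> upper_semicontinuous_on K f ->
  upper_semicontinuous_on K (fun x => sup (f @` cylinder K k x)).
Proof.
move=> cK uf x Kx c sc; have [M fM] := usc_bounded_above cK uf.
(* An intermediate level: the supremum over the cylinder of [y] inherits only a non-strict bound. *)
pose d := (sup [set f z | z in cylinder K k x] + c) / 2.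
have sd : sup [set f z | z in cylinder K k x] < d by rewrite /d; lra.
have dc : d < c by rewrite /d; lra.
move: cK => /compact_near_coveringP cK.
have A : \forall y \near nbhs x, K `<=` (fun z => K z -> agree_upto k y z -> f z < d).
  apply: cK => z Kz.
  have [xz|] := pselect (agree_upto k x z).
    exists ([set z | K z -> f z < d], setT); last by move=> [z' y] /= [h _] Kz' _; exact: h.
    split; last exact: filterT.
    apply: uf => //; apply: le_lt_trans sd; apply: ub_le_sup; last by exists z.
    by exists M => _ [w [Kw _] <-]; exact: fM.
  move=> /existsNP[i /not_implyP[ik /eqP xz]].
  pose e := `|Z i x - Z i z| / 2.
  have e0 : 0 < e by rewrite divr_gt0// normr_gt0 subr_eq0.
  exists ([set z' | `|Z i z - Z i z'| < e], [set y | `|Z i x - Z i y| < e]).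
    by split; exact: (canonical_process_continuous (nbhsx_ballx _ e e0)).
  move=> [z' y] /= [zz' yy'] Kz' /(_ i ik) yz'; exfalso.
  move: zz' yy'; rewrite yz' /e => h1 h2.
  have := ler_distD (Z i z') (Z i x) (Z i z).
  rewrite (distrC (Z i z') (Z i z)); lra.
near=> y; have Ky : K y.
  by near: y; exact: withinT.
have H : K `<=` (fun z => K z -> agree_upto k y z -> f z < d).
  by near: y; apply: cvg_within; exact: A.
apply: le_lt_trans dc; apply: ge_sup; first by exists (f y), y.
by move=> _ [z [Kz yz] <-]; apply/ltW/H.
Unshelve. all: by end_near. Qed.

End upper_semicontinuity.

(** * One-step super-replication *)

Section one_step.
Context {R : realType} {N : nat}.

Definition increment k (z : price_path R N) : R := Z k.+1 z - Z k z.

(* Capital needed at time [k] to super-replicate [U] at time [k+1] when the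
   stock position is [q], and the least such capital over all positions. *)
Definition hedge_cost (K : set (price_path R N)) k (U : price_path R N -> R) (q : R) x : R :=
  sup [set U z - q * increment k z | z in cylinder K k x].

Definition step_price K k U (x : price_path R N) : R :=
  inf (range (fun q => hedge_cost K k U q x)).

Lemma step_price_agree K k U (x y : price_path R N) :
  agree_upto k x y -> step_price K k U x = step_price K k U y.
Proof. by move=> xy; rewrite /step_price /hedge_cost (cylinder_agree K xy). Qed.

Lemma hedge_cost_agree K k U q (x y : price_path R N) :
  agree_upto k x y -> hedge_cost K k U q x = hedge_cost K k U q y.
Proof. by move=> xy; rewrite /hedge_cost (cylinder_agree K xy). Qed.

Lemma increment_continuous k : continuous (increment k).
Proof.
move=> x; apply: (@continuousB R) => /=; exact: canonical_process_continuous.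
Qed.

Variables (s a b : R).
Hypotheses (s_gt0 : 0 < s) (a_ge0 : 0 <= a) (a_le_b : a <= b).
Let K : set (price_path R N) := admissible_paths s `[a, b]%classic.
Variables (k : nat) (kN : (k < N)%N) (U : price_path R N -> R).
Hypotheses (uscU : upper_semicontinuous_on K U) (U_ge0 : forall x, K x -> 0 <= U x).

Let cK : compact K := compact_admissible_paths s_gt0 a_ge0 a_le_b.

Lemma usc_hedge_cost_integrand q :
  upper_semicontinuous_on K (fun z => U z - q * increment k z).
Proof.
apply: usc_addr_continuous => //.
have cq : continuous (fun z : price_path R N => q * increment k z).
  move=> x; have h := @increment_continuous k x.
  exact: (continuousM (@cst_continuous _ _ q x) h).
by move=> x; exact: (continuousN (cq x)).
Qed.

Lemma le_hedge_cost q x z : cylinder K k x z -> U z - q * increment k z <= hedge_cost K k U q x.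
Proof.
move=> xz; have [M HM] := usc_bounded_above cK (@usc_hedge_cost_integrand q).
apply: ub_le_sup; last by exists z.
by exists M => _ [w [Kw _] <-]; exact: HM.
Qed.

Lemma hedge_cost_le q x c : K x -> (forall z, cylinder K k x z -> U z - q * increment k z <= c) ->
  hedge_cost K k U q x <= c.
Proof.
move=> Kx H; apply: ge_sup; first by exists (U x - q * increment k x), x.
by move=> _ [z xz <-]; exact: H.
Qed.

Lemma cylinder_flip x z : cylinder K k x z -> cylinder K k x (flip k z).
Proof.
move=> [Kz xz]; split; first exact: flip_admissible.
by apply: agree_trans xz _; apply: flip_agree; exact: ltnW.
Qed.

Lemma increment_flip z : K z ->
  increment k (flip k z) = - (Z k z / Z k.+1 z) * increment k z.
Proof.
move=> Kz; rewrite /increment (flipE Kz kN) -(flip_agree _ (ltnW kN) (leqnn k)).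
by field; rewrite gt_eqF// (admissible_gt0 _ Kz).
Qed.

(** No arbitrage: on [x] or on its flip the position [q] gains nothing, and [U] is nonnegative
    there. *)
Lemma hedge_cost_ge0 q x : K x -> 0 <= hedge_cost K k U q x.
Proof.
move=> Kx; have xx : cylinder K k x x by [].
have [h|h] := leP (q * increment k x) 0.
  by apply: le_trans (le_hedge_cost q xx); have := U_ge0 Kx; lra.
apply: le_trans (le_hedge_cost q (cylinder_flip xx)).
have := U_ge0 (cylinder_flip xx).1; rewrite increment_flip//.
have r0 : 0 < Z k x / Z k.+1 x by rewrite divr_gt0// (admissible_gt0 _ Kx).
move: (Z k x / _) (increment k x) r0 h => r d r0 h; nra.
Qed.

Lemma step_price_le q x : K x -> step_price K k U x <= hedge_cost K k U q x.
Proof.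
move=> Kx; apply: ge_inf; last by exists q.
by exists 0 => _ [p _ <-]; exact: hedge_cost_ge0.
Qed.

Lemma step_price_ge0 x : K x -> 0 <= step_price K k U x.
Proof.
move=> Kx; apply: lb_le_inf; first by exists (hedge_cost K k U 0 x), 0.
by move=> _ [p _ <-]; exact: hedge_cost_ge0.
Qed.

Lemma usc_step_price : upper_semicontinuous_on K (step_price K k U).
Proof.
apply: (@usc_inf _ _ K R (hedge_cost K k U) 0) => [q x|q].
  exact: hedge_cost_ge0.
exact: usc_sup_cylinder (@usc_hedge_cost_integrand q).
Qed.

Lemma increment_le z : K z -> `|increment k z| <= s * expR b ^+ N.
Proof.
move=> Kz; have b1 : 1 <= expR b by rewrite -expR0 ler_expR (le_trans a_ge0).
have le i : (i <= N)%N -> Z i z <= s * expR b ^+ N.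
  move=> iN; apply: le_trans (admissible_paths_le s_gt0 a_ge0 a_le_b Kz iN) _.
  by rewrite ler_pM2l// ler_weXn2l.
have := le _ kN; have := le _ (ltnW kN).
have := admissible_gt0 k Kz; have := admissible_gt0 k.+1 Kz.
rewrite /increment ler_norml => *; apply/andP; lra.
Qed.

(** Increments are bounded on [K]; continuity in the position is what permits rational positions. *)
Lemma hedge_cost_lipschitz p q x : K x ->
  hedge_cost K k U p x <= hedge_cost K k U q x + `|q - p| * (s * expR b ^+ N).
Proof.
move=> Kx; apply: hedge_cost_le => // z xz.
have := le_hedge_cost q xz => h.
have : (q - p) * increment k z <= `|q - p| * (s * expR b ^+ N).
  apply: le_trans (ler_norm _) _; rewrite normrM ler_wpM2l//.
  by apply: increment_le; case: xz.
move: (`|_| * _) h => t; nra.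
Qed.

Lemma step_price_approx x e : K x -> 0 < e ->
  exists q : rat, hedge_cost K k U (ratr q) x < step_price K k U x + e.
Proof.
move=> Kx e0; have [] := @inf_adherent R (range (fun q => hedge_cost K k U q x)) e e0.
  split; first by exists (hedge_cost K k U 0 x), 0.
  by exists 0 => _ [p _ <-]; exact: hedge_cost_ge0.
move=> _ [q _ <-]; rewrite -/(step_price K k U x) => h.
pose D := s * expR b ^+ N.
have D0 : 0 < D by rewrite mulr_gt0// exprn_gt0// expR_gt0.
(* Shifting the position by less than [d] costs less than the slack left by [q]. *)
pose d := (step_price K k U x + e - hedge_cost K k U q x) / D.
have d0 : 0 < d by rewrite divr_gt0// subr_gt0.
have [p] : exists p : rat, ratr p \in `]q, (q + d)[ by apply: rat_in_itvoo; rewrite ltrDl.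
rewrite in_itv /= => /andP[qp pd]; exists p.
apply: le_lt_trans (hedge_cost_lipschitz _ q Kx) _; rewrite -/D.
rewrite distrC gtr0_norm ?subr_gt0// -ltrBrDl -ltr_pdivlMr//.
by rewrite -/d; lra.
Qed.

(* Separation on the line: if no two-point martingale law reached [c], the
   supremum of the slopes [(U u - c) / increment u] over upward moves [u]
   would be a position super-replicating [U] from [c]. *)
Lemma step_price_dual x c : K x -> c < step_price K k U x ->
  exists p u v, [/\ 0 <= p <= 1, cylinder K k x u, cylinder K k x v,
    p * increment k u + (1 - p) * increment k v = 0 & c <= p * U u + (1 - p) * U v].
Proof.
move=> Kx cx; apply: contrapT => H.
have no p u v : 0 <= p <= 1 -> cylinder K k x u -> cylinder K k x v ->
    p * increment k u + (1 - p) * increment k v = 0 -> p * U u + (1 - p) * U v < c.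
  move=> p01 xu xv m; rewrite ltNge; apply/negP => h.
  by apply: H; exists p, u, v; split.
(* The degenerate law with both points equal to [z]. *)
have flat z : cylinder K k x z -> increment k z = 0 -> U z < c.
  move=> xz z0; have := no 1 z z; rewrite lexx ler01 subrr !mul1r !mul0r !addr0.
  by apply.
have slopes u v : cylinder K k x u -> cylinder K k x v ->
    0 < increment k u -> increment k v < 0 ->
    (U u - c) / increment k u <= (U v - c) / increment k v.
  move=> xu xv u0 v0.
  have uv : 0 < increment k u - increment k v by lra.
  (* The weight for which the mean increment vanishes. *)
  pose p := - increment k v / (increment k u - increment k v).
  have p0 : 0 <= p by rewrite divr_ge0//; lra.
  have p1 : p <= 1 by rewrite ler_pdivrMr//; lra.
  have := no p u v; rewrite p0 p1 => /(_ isT xu xv).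
  have pE : 1 - p = increment k u / (increment k u - increment k v).
    by rewrite /p; field; rewrite gt_eqF.
  rewrite pE.
  have -> : p * increment k u + increment k u / (increment k u - increment k v) * increment k v = 0.
    by rewrite /p; field; rewrite gt_eqF.
  move=> /(_ erefl).
  have -> : p * U u + increment k u / (increment k u - increment k v) * U v =
     (increment k u * U v - increment k v * U u) / (increment k u - increment k v).
    by rewrite /p; field; rewrite gt_eqF.
  rewrite ltr_pdivrMr// => h.
  rewrite ler_pdivrMr// mulrAC ler_ndivlMr//; nra.
(* Without up-moves there are no down-moves either, by flipping; the price is then constant over
   this step and position 0 suffices. *)
have [[u [xu u0]]|noup] := pselect (exists u, cylinder K k x u /\ 0 < increment k u); last first.
  have : step_price K k U x <= c; last by rewrite leNgt cx.
  apply: le_trans (step_price_le 0 Kx) _; apply: hedge_cost_le => // z xz.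
  rewrite mul0r subr0; apply/ltW/flat => //; apply/eqP; rewrite eq_le; apply/andP; split.
    by rewrite leNgt; apply/negP => z0; apply: noup; exists z.
  rewrite leNgt; apply/negP => z0; apply: noup; exists (flip k z).
  split; first exact: cylinder_flip.
  rewrite increment_flip; last by case: xz.
  have := admissible_gt0 k xz.1; have := admissible_gt0 k.+1 xz.1 => h1 h2.
  by rewrite mulNr oppr_gt0 pmulr_rlt0// divr_gt0.
pose Sl := [set (U w - c) / increment k w | w in [set w | cylinder K k x w /\ 0 < increment k w]].
have Sl0 : Sl !=set0 by exists ((U u - c) / increment k u), u.
have Sub : has_ubound Sl.
  (* The flip of an up-move is a down-move, and its slope bounds all upward slopes. *)
  exists ((U (flip k u) - c) / increment k (flip k u)) => _ [w [xw w0] <-].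
  apply: slopes => //; first exact: cylinder_flip.
  rewrite increment_flip; last by case: xu.
  have := admissible_gt0 k xu.1; have := admissible_gt0 k.+1 xu.1 => h1 h2.
  by rewrite mulNr oppr_lt0 pmulr_rgt0// divr_gt0.
have : step_price K k U x <= c; last by rewrite leNgt cx.
apply: le_trans (step_price_le (sup Sl) Kx) _; apply: hedge_cost_le => // z xz.
have [z0|z0|z0] := ltgtP (increment k z) 0.
- have : sup Sl <= (U z - c) / increment k z.
    by apply: ge_sup => // _ [w [xw w0] <-]; exact: slopes.
  by rewrite ler_ndivlMr//; lra.
- have : (U z - c) / increment k z <= sup Sl by apply: ub_le_sup => //; exists z.
  by rewrite ler_pdivrMr//; lra.
- by rewrite z0 mulr0 subr0; apply/ltW/flat.
Qed.

End one_step.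

(** * Dynamic programming *)

Section portfolio.
Context {R : realType} {N : nat}.
Implicit Types (g : 'I_N -> price_path R N -> R) (K : set (price_path R N)).

Lemma portfolio_value0 (x : R) g S : portfolio_value x g 0 S = x.
Proof. by rewrite /portfolio_value big_pred0 ?addr0. Qed.

Lemma portfolio_valueS (x : R) g k (kN : (k < N)%N) S : portfolio_value x g k.+1 S =
  portfolio_value x g k S + g (Ordinal kN) S * increment k S.
Proof.
rewrite /portfolio_value (bigD1 (Ordinal kN)) //= addrCA addrC; congr (_ + _ + _).
by apply: eq_bigl => i; rewrite ltnS ltn_neqAle andbC -val_eqE.
Qed.

Lemma portfolio_value_agree K (x : R) g k u v : (forall i : 'I_N, nonanticipative_on K i (g i)) ->
  K u -> K v -> agree_upto k u v -> portfolio_value x g k u = portfolio_value x g k v.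
Proof.
move=> ng Ku Kv uv; congr (_ + _); apply: eq_bigr => i ik.
by rewrite (ng i u v)// ?uv// ?(ltnW ik)//; exact: agree_le (ltnW ik) uv.
Qed.

Lemma stopping_agree K (sigma : price_path R N -> 'I_N.+1) k u v :
  (forall (k : 'I_N.+1) u v, K u -> K v -> sigma u = k -> agree_upto k u v -> sigma v = k) ->
  K u -> K v -> agree_upto k u v -> (sigma u <= k)%N -> sigma v = sigma u.
Proof. by move=> H Ku Kv uv uk; apply: (H _ u v) => //; exact: agree_le uk uv. Qed.

End portfolio.

Section dynamic_programming.
Context {R : realType} {N : nat}.
Variables (s a b : R).
Hypotheses (s_gt0 : 0 < s) (a_ge0 : 0 <= a) (a_le_b : a <= b).
Let K : set (price_path R N) := admissible_paths s `[a, b]%classic.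
Variables F G : 'I_N.+1 -> price_path R N -> R.
Hypotheses (uscF : forall k, upper_semicontinuous_on K (F k))
  (uscG : forall k, upper_semicontinuous_on K (G k))
  (F_ge0 : forall k u, K u -> 0 <= F k u)
  (G_ge0 : forall k u, K u -> 0 <= G k u)
  (F_le_G : forall k u, K u -> F k u <= G k u)
  (naF : forall k : 'I_N.+1, nonanticipative_on K k (F k))
  (naG : forall k : 'I_N.+1, nonanticipative_on K k (G k)).

Let cK : compact K := compact_admissible_paths s_gt0 a_ge0 a_le_b.

(** Indexed by the number of remaining steps, which makes backward induction structural. *)
Fixpoint value_to_go (m : nat) : price_path R N -> R :=
  if m is m'.+1 then fun x =>
    Num.min (G (inord (N - m)) x)
      (Num.max (F (inord (N - m)) x) (step_price K (N - m) (value_to_go m') x))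
  else F (inord N).

Definition value k := value_to_go (N - k).

Lemma valueN : value N = F (inord N).
Proof. by rewrite /value subnn. Qed.

Lemma valueS k x : (k < N)%N -> value k x =
  Num.min (G (inord k) x) (Num.max (F (inord k) x) (step_price K k (value k.+1) x)).
Proof. by move=> kN; rewrite {1}/value -(subnSK kN) /= subnSK// subKn// ltnW. Qed.

Lemma value_to_go_usc m : (m <= N)%N -> upper_semicontinuous_on K (value_to_go m) /\
  (forall x, K x -> 0 <= value_to_go m x).
Proof.
elim: m => [|m ih] mN /=; first by split=> [|x]; [exact: uscF|exact: F_ge0].
have [u0 v0] := ih (ltnW mN); have kN : (N - m.+1 < N)%N by rewrite ltn_subrL (leq_ltn_trans _ mN).
split=> [|x Kx].
  by apply: usc_min; [exact: uscG|apply: usc_max; [exact: uscF|exact: usc_step_price]].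
by rewrite le_min G_ge0//= le_max F_ge0.
Qed.

Lemma usc_value k : upper_semicontinuous_on K (value k).
Proof. by case: (value_to_go_usc (leq_subr k N)). Qed.

Lemma value_ge0 k x : K x -> 0 <= value k x.
Proof. by case: (value_to_go_usc (leq_subr k N)) => _; exact. Qed.

Lemma value_agree k u v : (k <= N)%N -> K u -> K v -> agree_upto k u v -> value k u = value k v.
Proof.
rewrite leq_eqVlt => /orP[/eqP->|kN] Ku Kv uv.
  by rewrite valueN; apply: naF; rewrite ?inordK.
rewrite !valueS// (step_price_agree _ _ uv) (naF (k := inord k) Ku Kv) ?inordK ?ltnS ?(ltnW kN)//.
by rewrite (naG (k := inord k) Ku Kv) ?inordK ?ltnS ?(ltnW kN).
Qed.

Lemma F_le_value k x : (k <= N)%N -> K x -> F (inord k) x <= value k x.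
Proof.
rewrite leq_eqVlt => /orP[/eqP->|kN] Kx; first by rewrite valueN.
by rewrite valueS// le_min F_le_G//= le_max lexx.
Qed.

Lemma value_le_G k x : (k <= N)%N -> K x -> value k x <= G (inord k) x.
Proof.
rewrite leq_eqVlt => /orP[/eqP->|kN] Kx; first by rewrite valueN F_le_G.
by rewrite valueS// ge_min lexx.
Qed.

(** Where the buyer should wait, the value is at most the one-step price; where the seller should
    wait ([step_le_value]), it is at least that. Each inequality serves against the other player. *)
Lemma value_le_step k x : (k < N)%N -> F (inord k) x < value k x ->
  value k x <= step_price K k (value k.+1) x.
Proof.
move=> kN; rewrite valueS//; set m := Num.max _ _ => h.
apply: le_trans (_ : m <= _); first by rewrite ge_min lexx orbT.
move: h; rewrite /m lt_min => /andP[_]; rewrite lt_max ltxx /= => h.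
by rewrite ge_max lexx (ltW h).
Qed.

Lemma step_le_value k x : (k < N)%N -> value k x < G (inord k) x ->
  step_price K k (value k.+1) x <= value k x.
Proof.
move=> kN; rewrite valueS// gt_min ltxx /= => h.
by rewrite le_min (ltW (le_lt_trans _ h)) ?le_max ?lexx ?orbT.
Qed.

Lemma value_le_hedge x g (sigma : price_path R N -> 'I_N.+1) x0 :
  (forall i : 'I_N, nonanticipative_on K i (g i)) ->
  (forall (k : 'I_N.+1) u v, K u -> K v -> sigma u = k -> agree_upto k u v -> sigma v = k) ->
  perfect_hedge K F G x g sigma -> K x0 -> value 0 x0 <= x.
Proof.
move=> ng ns H Kx0; rewrite leNgt; apply/negP => xU.
(* Exercise at [k.+1], just after the cancellation, makes the seller owe [G]. *)
have hG k S : K S -> (k < N)%N -> sigma S = k :> nat -> G (inord k) S <= portfolio_value x g k S.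
  move=> KS kN sk; have := H S KS (inord k.+1).
  rewrite /game_payoff inordK ?ltnS// sk leqnn ltnn mulr1 mulr0 addr0 (minn_idPl _)//.
  by rewrite -[in inord k]sk inord_val.
have hF k S : K S -> (k <= N)%N -> (k <= sigma S)%N -> F (inord k) S <= portfolio_value x g k S.
  move=> KS kN sk; have := H S KS (inord k).
  by rewrite /game_payoff inordK ?ltnS// ltnNge sk /= mulr1 mulr0 add0r (minn_idPr _).
have path k : (k <= N)%N -> exists S, [/\ K S, portfolio_value x g k S < value k S & (k <= sigma S)%N].
  elim: k => [|k ih] kN; first by exists x0; rewrite portfolio_value0.
  have [S [KS VU ks]] := ih (ltnW kN).
  have {}ks : (k < sigma S)%N.
    rewrite ltn_neqAle ks andbT; apply/eqP => sk.
    have := hG k S KS kN (esym sk); rewrite leNgt (lt_le_trans VU)//.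
    exact: value_le_G (ltnW kN) KS.
  have Vstep : portfolio_value x g k S < step_price K k (value k.+1) S.
    apply: (lt_le_trans VU); apply: value_le_step => //.
    exact: le_lt_trans (hF k S KS (ltnW kN) (ltnW ks)) VU.
  (* Otherwise the current holding would super-replicate the next value on the whole cylinder from
     the current wealth. *)
  apply: contrapT => no; move: Vstep; apply/negP; rewrite -leNgt.
  have uV := @usc_value k.+1; have V0 := @value_ge0 k.+1.
  apply: le_trans (step_price_le s_gt0 a_ge0 a_le_b kN uV V0 (g (Ordinal kN) S) KS) _.
  apply: hedge_cost_le => // z [Kz Sz]; rewrite lerBlDr.
  have -> : portfolio_value x g k S = portfolio_value x g k z by exact: portfolio_value_agree.
  have -> : g (Ordinal kN) S = g (Ordinal kN) z by exact: (ng (Ordinal kN)).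
  rewrite -portfolio_valueS leNgt; apply/negP => h; apply: no; exists z; split=> //.
  rewrite ltnNge; apply/negP => zk; move: ks; apply/negP; rewrite -leqNgt.
  by rewrite (stopping_agree ns Kz KS (agree_sym Sz) zk).
have [S [KS VU Ns]] := path N (leqnn N).
have := hF N S KS (leqnn N) Ns; rewrite leNgt -valueN VU; exact: notF.
Qed.

(* Stopping at time [N] is forced, hence needs no [P]. *)
Definition is_first_time (P : nat -> price_path R N -> Prop) (tau : price_path R N -> 'I_N.+1) :=
  forall z, K z -> ((tau z < N)%N -> P (tau z) z) /\ forall j, (j < tau z)%N -> ~ P j z.

Lemma hedge_of_first_time e g sigma x0 : K x0 -> 0 <= e ->
  is_first_time (fun k z => G (inord k) z <= value k z) sigma ->
  (forall (k : 'I_N) S, K S ->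
     hedge_cost K k (value k.+1) (g k S) S <= step_price K k (value k.+1) S + e) ->
  perfect_hedge K F G (value 0 x0 + e *+ N) g sigma.
Proof.
move=> Kx0 e0 fs hg S KS.
have V k : (k <= sigma S)%N -> value k S <= portfolio_value (value 0 x0 + e *+ N) g k S.
  (* Stronger invariant: the portfolio still holds the allowance [e] for each of the [N - k]
     remaining steps. *)
  move=> ks; apply: (@le_trans _ _ (value k S + e *+ (N - k))).
    by rewrite lerDl mulrn_wge0.
  elim: k ks => [|k ih] ks.
    by rewrite subn0 portfolio_value0 (value_agree _ KS Kx0 (agree0 KS Kx0)).
  have kN : (k < N)%N by rewrite (leq_trans ks)// -ltnS.
  rewrite (portfolio_valueS _ _ kN); have {ih} := ih (ltnW ks).
  rewrite -(subnSK kN) mulrS => h.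
  have US : value k S < G (inord k) S.
    by rewrite ltNge; apply/negP; exact: (fs S KS).2.
  have sv := step_le_value kN US.
  have hc := hg (Ordinal kN) S KS.
  have := @le_hedge_cost _ _ _ _ _ s_gt0 a_ge0 a_le_b k (value k.+1) (@usc_value k.+1)
    (g (Ordinal kN) S) S S (conj KS (fun _ _ => erefl)).
  move: hc h sv => /=; rewrite -/K; lra.
move=> l; rewrite /game_payoff; have [sl|ls] := ltnP (sigma S) l.
  rewrite mulr1 mulr0 addr0.
  apply: le_trans (V _ (leqnn _)).
  have := (fs S KS).1; rewrite inord_val; apply.
  by rewrite (leq_trans sl)// -ltnS.
rewrite mulr1 mulr0 add0r; apply: le_trans (V _ ls).
by have := F_le_value (leq_ord l) KS; rewrite inord_val.
Qed.

(** * Finitely supported martingales *)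

Implicit Types l : seq (R * price_path R N).

(* A finitely supported law, as a list of (weight, path) pairs, that lives on the
   paths through [x] at time [k] and is a martingale from time [k] on. *)
Definition finite_martingale k x l :=
  [/\ forall t, t \in l -> 0 <= t.1, \sum_(t <- l) t.1 = 1,
      forall t, t \in l -> cylinder K k x t.2 &
      forall j (h : price_path R N -> R), (k <= j < N)%N -> nonanticipative_on K j h ->
        \sum_(t <- l) t.1 * (h t.2 * increment j t.2) = 0].

Definition mix (p : R) l1 l2 :=
  [seq (p * t.1, t.2) | t <- l1] ++ [seq ((1 - p) * t.1, t.2) | t <- l2].

Lemma sum_mix p l1 l2 (f : price_path R N -> R) : \sum_(t <- mix p l1 l2) t.1 * f t.2 =
  p * \sum_(t <- l1) t.1 * f t.2 + (1 - p) * \sum_(t <- l2) t.1 * f t.2.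
Proof.
rewrite big_cat !big_map !mulr_sumr; congr (_ + _); apply: eq_bigr => t _; by rewrite mulrA.
Qed.

Lemma sum_const l (f : price_path R N -> R) c : \sum_(t <- l) t.1 = 1 ->
  (forall t, t \in l -> f t.2 = c) -> \sum_(t <- l) t.1 * f t.2 = c.
Proof.
move=> l1 fc; rewrite -[RHS]mul1r -l1 mulr_suml big_seq [RHS]big_seq.
by apply: eq_bigr => t tl; rewrite fc.
Qed.

(** After [k] the condition is inherited from both parts. At [k] the test function is constant and
    the increment is constant on each part, so the condition is the two-point one. *)
Lemma finite_martingale_mix k x u v p l1 l2 : (k < N)%N -> K x ->
  cylinder K k x u -> cylinder K k x v -> 0 <= p <= 1 ->
  p * increment k u + (1 - p) * increment k v = 0 ->
  finite_martingale k.+1 u l1 -> finite_martingale k.+1 v l2 ->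
  finite_martingale k x (mix p l1 l2).
Proof.
move=> kN Kx [Ku xu] [Kv xv] /andP[p0 p1] m [w1 s1 c1 m1] [w2 s2 c2 m2].
have cyl y t : agree_upto k x y -> cylinder K k.+1 y t -> cylinder K k x t.
  by move=> xy [Kt yt]; split=> //; apply: agree_trans xy _; exact: agree_le yt.
split.
- move=> t; rewrite mem_cat => /orP[] /mapP[t' t'l ->] /=.
    by rewrite mulr_ge0// w1.
  by rewrite mulr_ge0 ?subr_ge0// w2.
- by rewrite big_cat /= !big_map -!mulr_sumr s1 s2 !mulr1 addrC subrK.
- move=> t; rewrite mem_cat => /orP[] /mapP[t' t'l ->] /=.
    by apply: cyl xu _; exact: c1.
  by apply: cyl xv _; exact: c2.
move=> j h /andP[kj jN] nh; rewrite (sum_mix p l1 l2 (fun z => h z * increment j z)).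
move: kj; rewrite leq_eqVlt => /orP[/eqP kj|kj]; last first.
  by rewrite m1 ?m2 ?kj//; rewrite !mulr0 addr0.
subst j.
have E y (l : seq (R * price_path R N)) : K y -> agree_upto k x y -> \sum_(t <- l) t.1 = 1 ->
    (forall t, t \in l -> cylinder K k.+1 y t.2) ->
    \sum_(t <- l) t.1 * (h t.2 * increment k t.2) = h x * increment k y.
  move=> Ky xy l1E cl; rewrite (@sum_const l (fun z => h z * increment k z) (h x * increment k y))//.
  move=> t /cl yt; have [Kt yt'] := yt; have [_ xt] := cyl _ _ xy yt.
  by rewrite (nh _ _ Kt Kx (agree_sym xt)) /increment !yt'.
by rewrite (E u l1 Ku xu s1 c1) (E v l2 Kv xv s2 c2) mulrCA [X in _ + X]mulrCA -mulrDr m mulr0.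
Qed.

(** The law is chosen before [sigma], hence serves against every cancellation time. The condition on
    the cylinder says that neither player has stopped before [k]. *)
Lemma finite_martingale_value tau : is_first_time (fun k z => value k z <= F (inord k) z) tau ->
  forall k x e, (k <= N)%N -> K x -> 0 < e -> exists l, finite_martingale k x l /\
    forall sigma : price_path R N -> 'I_N.+1,
      (forall (k : 'I_N.+1) u v, K u -> K v -> sigma u = k -> agree_upto k u v -> sigma v = k) ->
      (forall z, cylinder K k x z -> (k <= sigma z)%N /\ (k <= tau z)%N) ->
      value k x - e <= \sum_(t <- l) t.1 * game_payoff F G (sigma t.2) (tau t.2) t.2.
Proof.
move=> ft k x e kN; rewrite -(subKn kN); move: (N - k)%N (leq_subr k N) => m.
elim: m x e => [|m ih] x e mN Kx e0.
  have xx : cylinder K (N - 0) x x by [].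
  exists [:: (1, x)]; split.
    split=> [t||t|j h]; rewrite ?inE.
    - by move=> /eqP->.
    - by rewrite big_seq1.
    - by move=> /eqP ->.
    - by rewrite subn0 andbC => /andP[jN]; rewrite leqNgt jN.
  move=> sigma _ /(_ x xx); rewrite big_seq1 subn0 mul1r => -[Ns Nt].
  have sN : sigma x = inord N by apply/val_inj; rewrite /= inordK//; apply/eqP; rewrite eqn_leq Ns -ltnS ltn_ord.
  have tN : tau x = inord N by apply/val_inj; rewrite /= inordK//; apply/eqP; rewrite eqn_leq Nt -ltnS ltn_ord.
  by rewrite /game_payoff sN tN ltnn leqnn mulr0 mulr1 add0r valueN gerBl ltW.
set k' := (N - m.+1)%N; have k'E : (N - m)%N = k'.+1 by rewrite /k' subnSK.
have k'N : (k' < N)%N by rewrite -k'E leq_subr.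
have e20 : 0 < e / 2 by rewrite divr_gt0.
have uV := @usc_value k'.+1; have V0 := @value_ge0 k'.+1.
(* Half of [e] pays for the dual pair, the other half for the two continuations. *)
have [|p [u [v [p01 xu xv mart cle]]]] := @step_price_dual _ _ _ _ _ s_gt0 a_ge0 a_le_b
  _ k'N _ uV V0 x (step_price K k' (value k'.+1) x - e / 2) Kx; first by rewrite gtrBl.
have [l1 [fl1 H1]] := ih u (e / 2) (ltnW mN) xu.1 e20.
have [l2 [fl2 H2]] := ih v (e / 2) (ltnW mN) xv.1 e20.
rewrite k'E in fl1 fl2 H1 H2.
have fl := finite_martingale_mix k'N Kx xu xv p01 mart fl1 fl2.
exists (mix p l1 l2); split=> // sigma ns st.
have [_ s1 cl _] := fl.
have const c : (forall z, cylinder K k' x z -> game_payoff F G (sigma z) (tau z) z = c) ->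
    \sum_(t <- mix p l1 l2) t.1 * game_payoff F G (sigma t.2) (tau t.2) t.2 = c.
  move=> Hc; apply: (@sum_const _ (fun z => game_payoff F G (sigma z) (tau z) z)) => // t tl.
  exact/Hc/cl.
(* In the first case [tau] stops at [k']; ties go to the buyer, so the payoff is [F] whatever
   [sigma] does. *)
have [UF|FU] := leP (value k' x) (F (inord k') x).
  rewrite (const (F (inord k') x)); first by rewrite lerBlDr (le_trans UF)// lerDl ltW.
  move=> z xz; have [Kz az] := xz; have [sz tz] := st z xz.
  have tk : tau z = k' :> nat.
    apply/eqP; rewrite eqn_leq tz andbT leqNgt; apply/negP => /(ft z Kz).2; apply.
    rewrite -(value_agree (ltnW k'N) Kx Kz az) (le_trans UF)//.
    by rewrite (naF (k := inord k') Kx Kz)// inordK// ltnS ltnW.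
  rewrite /game_payoff ltnNge tk sz /= mulr0 mulr1 add0r -[in RHS]tk inord_val.
  by apply: naF => //; rewrite tk; exact: agree_sym.
have t1 z : cylinder K k' x z -> (k' < tau z)%N.
  move=> xz; have [Kz az] := xz; have [_ tz] := st z xz.
  rewrite ltn_neqAle tz andbT; apply/eqP => kt.
  have := (ft z Kz).1; rewrite -kt => /(_ k'N).
  rewrite -(value_agree (ltnW k'N) Kx Kz az) -(naF (k := inord k') Kx Kz) ?inordK ?ltnS ?(ltnW k'N)//.
  by rewrite leNgt FU.
(* Whether [sigma] stops at [k'] is constant on the cylinder, so it is tested at [x]. *)
have [sk|sk] := eqVneq (sigma x : nat) k'.
  rewrite (const (G (inord k') x)).
    by rewrite lerBlDr (le_trans (value_le_G (ltnW k'N) Kx))// lerDl ltW.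
  move=> z xz; have [Kz az] := xz.
  have sz : sigma z = sigma x by apply: (stopping_agree ns Kx Kz az); rewrite sk.
  rewrite /game_payoff sz sk t1// leqNgt t1//= mulr1 mulr0 addr0 -[in RHS]sk inord_val.
  by apply: naG => //; rewrite sk; exact: agree_sym.
have st1 y z : cylinder K k' x y -> cylinder K k'.+1 y z -> (k' < sigma z)%N /\ (k' < tau z)%N.
  move=> [Ky xy] [Kz yz]; have xz : cylinder K k' x z.
    by split=> //; apply: agree_trans xy _; exact: agree_le yz.
  split; last exact: t1.
  rewrite ltnNge; apply/negP => zk.
  have := stopping_agree ns Kz Kx (agree_sym xz.2) zk => sxz.
  have := (st x (conj Kx (fun _ _ => erefl))).1.
  by rewrite leq_eqVlt eq_sym (negbTE sk) /= sxz ltnNge zk.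
rewrite (sum_mix p l1 l2 (fun z => game_payoff F G (sigma z) (tau z) z)).
have h1 := H1 sigma ns (fun z => @st1 u z xu); have h2 := H2 sigma ns (fun z => @st1 v z xv).
have vs := value_le_step k'N FU; move/andP: p01 => [p0 p1].
apply: le_trans (_ : p * (value k'.+1 u - e / 2) + (1 - p) * (value k'.+1 v - e / 2) <= _).
  move: vs cle; lra.
by apply: lerD; rewrite ler_wpM2l ?subr_ge0.
Qed.

End dynamic_programming.

(** * Filtration and stopping times *)

Section borel_paths.
Context {R : realType} {N : nat}.
Local Notation T := (borel_path R N).

(* An open set is the countable union of the rational balls it contains. *)
Lemma measurable_fun_path d (X : measurableType d) (f : X -> T) :
  (forall i, (i <= N)%N -> measurable_fun setT (fun x => Z i (f x))) -> measurable_fun setT f.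
Proof.
move=> mf; apply: (@measurability _ _ X T setT f (@open (price_path R N) : set (set T)) erefl) => _ [W oW <-].
rewrite setTI.
pose c (q : 'rV[rat]_N.+1) : price_path R N := map_mx ratr q.
pose B (qn : 'rV[rat]_N.+1 * nat) : set (price_path R N) := ball (c qn.1) (qn.2.+1%:R^-1).
(* A ball not contained in [W] contributes the empty set, so the union runs over a whole countable
   type. *)
pose E qn := [set x | B qn `<=` W /\ B qn (f x)].
have -> : f @^-1` W = \bigcup_qn E qn.
  apply/seteqP; split=> [x Wx|x [qn _]]; last first.
    by move=> [BW]; exact: BW.
  have /nbhs_ballP[e /= e0 eW] : nbhs (f x : price_path R N) W.
    exact: open_nbhs_nbhs.
  have [n ne] : exists n : nat, n.+1%:R^-1 < e / 2.
    have e2 : 0 < e / 2 by rewrite divr_gt0.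
    have /ltr_add_invr := e2; case=> n; rewrite add0r => h; by exists n.
  have n0 : (0 : R) < n.+1%:R^-1 by rewrite invr_gt0.
  have H j : exists q : rat, `|(f x : price_path R N) ord0 j - ratr q| < n.+1%:R^-1.
    have [q] : exists q : rat,
        ratr q \in `]((f x : price_path R N) ord0 j - n.+1%:R^-1),
                    ((f x : price_path R N) ord0 j + n.+1%:R^-1)[.
      by apply: rat_in_itvoo;
        apply: (@lt_trans _ _ ((f x : price_path R N) ord0 j)); rewrite ?ltrDl ?gtrBl.
    by rewrite in_itv /= => /andP[h1 h2]; exists q; rewrite ltr_distlC h1.
  have [q qP] := choice H.
  have fB : B (\row_j q j, n) (f x).
    split=> // i j; rewrite (ord1 i) !mxE; apply: ball_sym.
    by rewrite -ball_normE /=.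
  exists (\row_j q j, n) => //; split=> //.
  move=> y yB; apply: eW; rewrite (splitr e).
  apply: (ball_triangle _ (le_ball (ltW ne) yB)); apply: ball_sym.
  exact: (le_ball (ltW ne) fB).
apply: countable_bigcupT_measurable => [|qn]; first exact: countableP.
have [BW|nBW] := pselect (B qn `<=` W); last first.
  rewrite (_ : E qn = set0); first exact: measurable0.
  by apply/seteqP; split=> x // -[].
rewrite (_ : E qn = f @^-1` B qn); last by apply/seteqP; split=> x // -[].
have -> : f @^-1` B qn = \bigcap_(j in [set: 'I_N.+1])
    ((fun x => Z j (f x)) @^-1` ball (c qn.1 ord0 j) (qn.2.+1%:R^-1)).
  apply/seteqP; split=> x.
    by move=> [_ h] j _ /=; rewrite /canonical_process inord_val; exact: h.
  move=> h; split=> [|i j]; first by rewrite invr_gt0.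
  by have := h j Logic.I; rewrite (ord1 i) /= /canonical_process inord_val.
apply: fin_bigcap_measurable => // j _; rewrite -[X in measurable X]setTI.
by apply: mf => //; [exact: leq_ord|exact: measurable_ball].
Qed.

Lemma measurable_closed_path (A : set (price_path R N)) : closed A -> measurable (A : set T).
Proof.
move=> cA; rewrite -[X in measurable X]setCK; apply: measurableC.
by apply: sub_sigma_algebra; exact: closed_openC.
Qed.

Lemma canonical_process_measurable i : measurable_fun setT (Z i : T -> R).
Proof.
apply: (measurability _ (RGenOpens.measurableE R)) => // _ [_ [x [y ->]] <-].
rewrite setTI; apply: sub_sigma_algebra.
by apply: open_comp => [z _|]; [exact: canonical_process_continuous|exact: interval_open].
Qed.

Local Notation filtered k := (g_sigma_algebraType
  (\big[setU/set0]_(i < k.+1) preimage_set_system setT (Z i : T -> R) measurable)).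

Lemma filtrationP k (A : set T) : canonical_filtration k A <-> measurable (A : set (filtered k)).
Proof. by []. Qed.

Lemma filtration_gen k i (B : set R) : (i <= k)%N -> measurable B ->
  canonical_filtration k (Z i @^-1` B : set T).
Proof.
move=> ik mB; apply: sub_sigma_algebra.
rewrite (bigD1 (Ordinal (ik : (i < k.+1)%N))) //=; left; exists B => //; exact: setTI.
Qed.

Lemma filtration_sub k (C : set (set T)) : sigma_algebra setT C ->
  (forall i B, (i <= k)%N -> measurable B -> C (Z i @^-1` B : set T)) ->
  canonical_filtration k `<=` C.
Proof.
move=> sC H; apply: smallest_sub => //.
elim/big_ind: _ => // [A1 A2 h1 h2 A [/h1|/h2]//|i _ _ [B mB <-]].
by rewrite setTI; apply: H => //; rewrite -ltnS.
Qed.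

Lemma sigma_algebra_measurable_type d (X : measurableType d) :
  sigma_algebra setT (@measurable d X).
Proof.
split=> [|A mA|A mA]; [exact: measurable0|exact: measurableD|exact: bigcupT_measurable].
Qed.

Lemma filtration_measurable k (A : set T) : canonical_filtration k A -> measurable A.
Proof.
apply: filtration_sub; first exact: sigma_algebra_measurable_type.
by move=> i B _ mB; rewrite -[X in measurable X]setTI; exact: canonical_process_measurable.
Qed.

Lemma filtration_mono k l (A : set T) : (k <= l)%N -> canonical_filtration k A -> canonical_filtration l A.
Proof.
move=> kl; apply: filtration_sub; first exact: (sigma_algebra_measurable_type (filtered l)).
by move=> i B ik mB; apply: filtration_gen => //; exact: leq_trans kl.
Qed.

(** The sets invariant under [agree_upto k] form a sigma-algebra, complements being covered by
    symmetry. *)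
Lemma filtration_agree k (A : set T) u v : canonical_filtration k A -> agree_upto k u v -> A u -> A v.
Proof.
move=> FA; suff : [set A : set T | forall u v, agree_upto k u v -> A u -> A v] A by apply.
move: A FA; apply: filtration_sub; last by move=> i B ik _ x y xy /=; rewrite xy.
split=> //= [A H x y xy [_ nAx]|A H x y xy [n _ Anx]].
  by split=> // Ay; apply: nAx; apply: H (agree_sym xy) Ay.
by exists n => //; exact: H xy Anx.
Qed.

Lemma filtrationC k (A : set T) : canonical_filtration k A -> canonical_filtration k (~` A).
Proof. by move=> /filtrationP mA; apply/filtrationP; exact: measurableC. Qed.

Lemma filtrationI k (A B : set T) : canonical_filtration k A -> canonical_filtration k B ->
  canonical_filtration k (A `&` B).
Proof. by move=> /filtrationP mA /filtrationP mB; apply/filtrationP; exact: measurableI. Qed.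

Lemma canonical_process_adapted i k : (i <= k)%N ->
  measurable_fun setT (Z i : filtered k -> R).
Proof. by move=> ik _ B mB; rewrite setTI; exact: filtration_gen. Qed.

Lemma stop_extend_adapted (a : R) k : (k <= N)%N ->
  measurable_fun setT (stop_extend a k : filtered k -> T).
Proof.
move=> kN; apply: measurable_fun_path => i iN.
rewrite (_ : (fun x => _) = fun x : filtered k =>
    if (i <= k)%N then Z i x else Z k x * expR a ^+ (i - k)).
  have [ik|_] := leqP i k; first exact: canonical_process_adapted.
  by apply: measurable_funM => //; exact: canonical_process_adapted.
by apply/funext => x; rewrite path_ofE.
Qed.

(** * Stopping times and first entry times *)

Section stopping.
Variables (s a b : R).
Hypotheses (s_gt0 : 0 < s) (a_ge0 : 0 <= a) (a_le_b : a <= b).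
Let K : set (price_path R N) := admissible_paths s `[a, b]%classic.

(** A converse of [filtration_agree] on [K]: the preimage of [A] under [stop_extend a k] depends
    measurably on the prefix, and invariance identifies it with [A] on [K]. *)
Lemma filtration_restrict k (A : set T) : (k <= N)%N -> measurable A ->
  (forall u v, K u -> K v -> agree_upto k u v -> A u -> A v) ->
  exists C : set T, canonical_filtration k C /\ forall z, K z -> C z <-> A z.
Proof.
move=> kN mA sA; exists (stop_extend a k @^-1` A); split.
  apply/filtrationP; rewrite -[X in measurable X]setTI.
  exact: (stop_extend_adapted a kN).
move=> z Kz /=; have Kz' := stop_extend_admissible s_gt0 a_ge0 a_le_b Kz kN.
have zz' := @stop_extend_agree _ _ a k z kN.
by split; apply: sA => //; exact: agree_sym.
Qed.

(** An unsuccessful [find] returns the length [N] of the list, which is the forced stop at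
    maturity. *)
Definition first_time (C : nat -> set T) (z : T) : 'I_N.+1 :=
  inord (find (fun j => `[< C j z >]) (iota 0 N)).

Lemma first_timeE C z : first_time C z = find (fun j => `[< C j z >]) (iota 0 N) :> nat.
Proof. by rewrite inordK// ltnS -[X in (_ <= X)%N](size_iota 0 N) find_size. Qed.

Lemma first_time_hit C z : (first_time C z < N)%N -> C (first_time C z) z.
Proof.
rewrite first_timeE => h; have : has (fun j => `[< C j z >]) (iota 0 N).
  by rewrite has_find size_iota.
move=> /(nth_find 0%N).
by rewrite nth_iota// add0n => /asboolP.
Qed.

Lemma first_time_before C z j : (j < first_time C z)%N -> ~ C j z.
Proof.
rewrite first_timeE => h; have := before_find 0%N h; rewrite nth_iota ?add0n => [/asboolP//|].
by rewrite (leq_trans h)// -[X in (_ <= X)%N](size_iota 0 N) find_size.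
Qed.

Lemma first_time_stopping C : (forall k, (k < N)%N -> canonical_filtration k (C k)) ->
  stopping_times (first_time C).
Proof.
move=> FC k; have := leq_ord k; rewrite leq_eqVlt => /orP[/eqP ->|kN].
  rewrite (_ : [set _ | _] = setT); first by apply/filtrationP; exact: measurableT.
  by apply/seteqP; split=> // z _ /=; rewrite -ltnS.
rewrite (_ : [set _ | _] = \bigcup_(j in [set j | (j <= k)%N]) C j).
  apply/filtrationP; apply: bigcup_measurable => j /= jk.
  by apply: (filtration_mono jk); apply: FC; exact: (leq_ltn_trans jk kN).
apply/seteqP; split=> z /= => [h|[j /= jk Cj]].
  by exists (first_time C z) => //; apply: first_time_hit; exact: (leq_ltn_trans h kN).
by rewrite leqNgt; apply/negP => kt; apply: (@first_time_before C z j) => //; exact: (leq_ltn_trans jk kt).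
Qed.

Lemma stopping_times_agree (sigma : T -> 'I_N.+1) (k : 'I_N.+1) u v : stopping_times sigma ->
  sigma u = k -> agree_upto k u v -> sigma v = k.
Proof.
move=> st su uv; have vk : (sigma v <= k)%N.
  by apply: (filtration_agree (st k) uv) => /=; rewrite su.
(* The reverse inequality is the same argument at time [sigma v], which is at most [k]. *)
apply/val_inj/eqP; rewrite eqn_leq /= vk /= -su.
by apply: (filtration_agree (st (sigma v)) (agree_sym (agree_le vk uv))) => /=.
Qed.

Lemma stopping_times_eq (sigma : T -> 'I_N.+1) (k : 'I_N.+1) : stopping_times sigma ->
  canonical_filtration k [set z | sigma z = k].
Proof.
move=> st; have -> : [set z | sigma z = k] = [set z | (sigma z <= k)%N] `\`
    \bigcup_(j in [set j : 'I_N.+1 | (j < k)%N]) [set z | (sigma z <= j)%N].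
  apply/seteqP; split=> z /= => [<-|[zk nz]].
    by split=> // -[j /= jz zj]; rewrite ltnNge zj in jz.
  apply/val_inj/eqP; rewrite eqn_leq zk /= leqNgt; apply/negP => h; apply: nz.
  by exists (sigma z) => /=.
apply/filtrationP; apply: measurableD; first exact: st.
apply: fin_bigcup_measurable => // j /= jk.
by apply: (filtration_mono (ltnW jk)); exact: st.
Qed.

Lemma stopping_times_measurable (sigma : T -> 'I_N.+1) (B : set 'I_N.+1) :
  stopping_times sigma -> measurable (sigma @^-1` B).
Proof.
move=> st; rewrite (_ : _ @^-1` _ = \bigcup_(k in B) [set z | sigma z = k]).
  by apply: fin_bigcup_measurable => // k _; apply: (@filtration_measurable k); exact: stopping_times_eq.
by apply/seteqP; split=> z /= => [Bz|[k Bk ->]//]; exists (sigma z).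
Qed.

Lemma stopping_times_on (sigma : T -> 'I_N.+1) : stopping_times sigma -> stopping_time_on K sigma.
Proof.
move=> st; split=> [mK B mB|k u v _ _]; last exact: stopping_times_agree.
apply: measurableI => //.
exact: (@stopping_times_measurable sigma [set k | B (k : nat)]).
Qed.

Lemma game_payoff_measurable (F G : 'I_N.+1 -> price_path R N -> R) (sigma tau : T -> 'I_N.+1) :
  (forall k, upper_semicontinuous_on K (F k)) -> (forall k, upper_semicontinuous_on K (G k)) ->
  stopping_times sigma -> stopping_times tau ->
  measurable_fun (K : set T) (fun z => game_payoff F G (sigma z) (tau z) z).
Proof.
move=> uF uG ss st mK B mB.
rewrite (_ : _ `&` _ = \bigcup_(kl in [set: 'I_N.+1 * 'I_N.+1])
   ([set z | sigma z = kl.1] `&` [set z | tau z = kl.2] `&`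
    (K `&` game_payoff F G kl.1 kl.2 @^-1` B))); last first.
  apply/seteqP; split=> z /= => [[Kz Bz]|[[k l] _ [[/= -> ->] //]]].
  by exists (sigma z, tau z).
apply: fin_bigcup_measurable => // kl _; apply: measurableI; first apply: measurableI.
- apply: (@filtration_measurable kl.1); exact: stopping_times_eq.
- apply: (@filtration_measurable kl.2); exact: stopping_times_eq.
rewrite /game_payoff.
have mG := usc_measurable mK (uG kl.1); have mF := usc_measurable mK (uF kl.2).
have : measurable_fun (K : set T)
   (fun S => G kl.1 S * (kl.1 < kl.2)%N%:R + F kl.2 S * (kl.2 <= kl.1)%N%:R).
  by apply: measurable_funD; apply: measurable_funM => //; exact: measurable_cst.
exact.
Qed.

End stopping.
End borel_paths.

(** * Martingale laws *)

Section finite_law.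
Context d (T : measurableType d) (R : realType).
Variable l : seq (R * T).
Hypotheses (l_ge0 : forall t, t \in l -> 0 <= t.1) (l_sum : \sum_(t <- l) t.1 = 1).

Let m (i : nat) : {measure set T -> \bar R} :=
  mscale (`|(nth (0, point) l i).1|%:nng) \d_((nth (0, point) l i).2).

Let mu : {measure set T -> \bar R} := msum m (size l).

(** Absolute values and normalisation yield a probability for every list; for nonnegative weights of
    sum 1 they change nothing. *)
Definition finite_law : probability T R := mnormalize mu \d_point.

Let sumE (h : T -> R) : (\sum_(i < size l) (`|(nth (0, point) l i).1| * h (nth (0, point) l i).2)%:E)%E =
  (\sum_(t <- l) t.1 * h t.2)%:E.
Proof.
rewrite sumEFin; congr EFin; rewrite (big_nth (0, point)) big_mkord.
by apply: eq_bigr => i _; rewrite ger0_norm// l_ge0// mem_nth.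
Qed.

Let muE (A : set T) : mu A = (\sum_(t <- l) t.1 * \1_A t.2)%:E.
Proof. by rewrite -sumE /mu /msum; apply: eq_bigr => i _; rewrite EFinM. Qed.

Let finite_lawE (A : set T) : finite_law A = mu A.
Proof.
have mu1 : mu setT = 1%E.
  by rewrite muE; congr EFin; rewrite -[RHS]l_sum; apply: eq_bigr => t _; rewrite indicT mulr1.
transitivity (@mnormalize _ _ _ mu \d_point A); first by [].
rewrite /mnormalize mu1 (_ : (_ || _) = false); last by rewrite eqe oner_eq0.
by rewrite -[RHS]mule1; congr (_ * _)%E; congr EFin; exact: invr1.
Qed.

Lemma finite_law_set (A : set T) : (forall t, t \in l -> A t.2) -> finite_law A = 1%E.
Proof.
move=> lA; rewrite finite_lawE muE; congr EFin; rewrite -[RHS]l_sum.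
by rewrite big_seq [RHS]big_seq; apply: eq_bigr => t /lA At; rewrite indicE mem_set ?mulr1.
Qed.

Let ge0_integral (D : set T) (h : T -> R) : measurable D -> measurable_fun D h ->
  (forall x, D x -> 0 <= h x) ->
  (\int[finite_law]_(x in D) (h x)%:E = (\sum_(t <- l) t.1 * (h t.2 * \1_D t.2))%:E)%E.
Proof.
move=> mD mh h0; have mh' : measurable_fun D (EFin \o h) by exact/measurable_EFinP.
rewrite (eq_measure_integral mu); last by move=> A mA _; exact: finite_lawE.
rewrite /mu ge0_integral_measure_sum//.
rewrite -(sumE (fun x => h x * \1_D x)); apply: eq_bigr => i _.
rewrite ge0_integral_mscale//= integral_dirac// diracE -indicE.
by rewrite EFinM EFinM [X in (_ * X)%E]muleC.
Qed.

Lemma integral_finite_law (D : set T) (h : T -> R) : measurable D -> measurable_fun D h ->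
  (\int[finite_law]_(x in D) (h x)%:E = (\sum_(t <- l) t.1 * (h t.2 * \1_D t.2))%:E)%E.
Proof.
move=> mD mh; rewrite integralE.
rewrite (eq_integral (fun x => (Num.max (h x) 0)%:E)); last
  by move=> x _; rewrite funeposE EFin_max.
rewrite [X in (_ - X)%E](eq_integral (fun x => (Num.max (- h x) 0)%:E)); last
  by move=> x _; rewrite funenegE EFin_max.
have part (g : T -> R) : measurable_fun D g -> (\int[finite_law]_(x in D) (Num.max (g x) 0)%:E =
    (\sum_(t <- l) t.1 * (Num.max (g t.2) 0 * \1_D t.2))%:E)%E.
  move=> mg; rewrite (ge0_integral (h := fun x => Num.max (g x) 0))//.
    by apply: measurable_maxr => //; exact: measurable_cst.
  by move=> x _; rewrite le_max lexx orbT.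
rewrite (part h mh) (part (fun x => - h x)); last exact: measurable_funN.
rewrite -EFinB; congr EFin; rewrite -sumrB; apply: eq_bigr => t _.
rewrite -mulrBr -mulrBl; congr (_ * (_ * _)).
by rewrite /Num.max; case: ltP => h1; case: ltP => h2; lra.
Qed.

Lemma integrable_finite_law (h : T -> R) : measurable_fun setT h ->
  finite_law.-integrable setT (EFin \o h).
Proof.
move=> mh; apply/integrableP; split; first exact/measurable_EFinP.
rewrite (eq_integral (fun x => `|h x|%:E))//.
by rewrite ge0_integral// ?ltry//; exact: measurableT_comp.
Qed.

End finite_law.

(** * Gains from trading under a martingale law *)

Section martingale_laws.
Context {R : realType} {N : nat}.
Local Notation T := (borel_path R N).
Variables (s a b : R).
Hypotheses (s_gt0 : 0 < s) (a_ge0 : 0 <= a) (a_le_b : a <= b).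
Let K : set (price_path R N) := admissible_paths s `[a, b]%classic.
Let mK : measurable (K : set T) := measurable_closed_path (closed_admissible_paths s_gt0 a_ge0).

Lemma finite_martingale_law (l : seq (R * T)) x : finite_martingale s a b 0 x l ->
  martingale_laws K (finite_law l).
Proof.
move=> [l0 l1 cl ml]; split; first by apply: finite_law_set => // t /cl[].
move=> k kN; have mZ i := @canonical_process_measurable R N i.
split; [exact: integrable_finite_law|exact: integrable_finite_law| |].
  by move=> B mB; exact: filtration_gen.
move=> E FE; have mE := filtration_measurable FE.
have mZE i : measurable_fun E (Z i : T -> R) by exact: measurable_funTS.
rewrite !integral_finite_law//; congr EFin.
(* Telescoping from [k] to [N], with the indicator of [E] as test function for each increment. *)
have H j : (k + j <= N)%N -> \sum_(t <- l) t.1 * (Z (k + j) t.2 * \1_E t.2) =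
    \sum_(t <- l) t.1 * (Z k t.2 * \1_E t.2).
  elim: j => [|j ih] jN; first by rewrite addn0.
  rewrite -ih; last by rewrite (leq_trans _ jN)// leq_add2l.
  apply/eqP; rewrite -subr_eq0 -sumrB; apply/eqP.
  rewrite -[RHS](ml (k + j)%N \1_E) => [|/=|u v Ku Kv uv].
  - by apply: eq_bigr => t _; rewrite -mulrBr -mulrBl mulrC /increment addnS; ring.
  - by rewrite (leq_trans _ jN)// addnS.
  have FE' := filtration_mono (leq_addr j k) FE.
  rewrite !indicE; congr (_%:R); congr nat_of_bool; apply/idP/idP; rewrite !inE.
    exact: (filtration_agree FE' uv).
  exact: (filtration_agree FE' (agree_sym uv)).
by have := H (N - k)%N; rewrite subnKC ?(ltnW kN)// => ->.
Qed.

Lemma measurable_countable_position i (E : set T) (idx : T -> nat) (q : nat -> R) : measurable E ->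
  (forall n, exists A : set T, canonical_filtration i A /\ forall z, K z -> A z <-> idx z = n) ->
  measurable_fun (E `&` K) (fun z : T => q (idx z)).
Proof.
move=> mE /choice[A HA] mEK B mB.
have -> : (E `&` K) `&` (fun z => q (idx z)) @^-1` B =
    \bigcup_(n in [set n | B (q n)]) ((E `&` A n) `&` (K : set T)).
  apply/seteqP; split=> z /=.
    by move=> [[Ez Kz] Bz]; exists (idx z) => //; split=> //; split=> //; apply/(HA (idx z)).2.
  by move=> [n /= Bn [[Ez An] Kz]]; rewrite ((HA n).2 z Kz).1.
apply: bigcup_measurable => n _; apply: measurableI => //; apply: measurableI => //.
exact: filtration_measurable (HA n).1.
Qed.

Variable P : probability T R.
Hypothesis PM : martingale_laws K P.

Lemma integrable_process i j (E : set T) : (i < N)%N -> (i <= j <= N)%N -> measurable E ->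
  P.-integrable E (EFin \o (Z j : T -> R)).
Proof.
move=> iN /andP[ij jN] mE; have [_ mart] := PM.
apply: (@integrableS _ _ _ _ setT) => //.
(* For [j = N] integrability comes from the condition at time [i]. *)
by move: jN; rewrite leq_eqVlt => /orP[/eqP -> |jN]; [have [] := mart i iN|have [] := mart j jN].
Qed.

Lemma integrable_increment i (E : set T) : (i < N)%N -> measurable E ->
  P.-integrable E (fun z => (increment i z)%:E).
Proof.
move=> iN mE; rewrite (_ : (fun z => _) = fun z => ((Z i.+1 z)%:E - (Z i z)%:E)%E)//.
by apply: integrableB => //; apply: (integrable_process iN); rewrite ?iN ?leqnn ?leqnSn ?(ltnW iN).
Qed.

(** The law relates each price to [Z N] only: over [E] both ends of the increment have the integral
    of [Z N]. *)
Lemma integral_increment i (E : set T) : (i < N)%N -> canonical_filtration i E ->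
  (\int[P]_(z in E `&` K) (increment i z)%:E = 0)%E.
Proof.
move=> iN FE; have mE := filtration_measurable FE.
have [PK mart] := PM; have [_ _ _ mi] := mart i iN.
have iZ := integrable_process iN _ mE.
have eqj : (\int[P]_(z in E) (Z i.+1 z)%:E = \int[P]_(z in E) (Z N z)%:E)%E.
  have := iN; rewrite leq_eqVlt => /orP[/eqP -> //|i1N].
  by have [_ _ _] := mart _ i1N; apply; exact: filtration_mono FE.
have inc0 : (\int[P]_(z in E) (increment i z)%:E = 0)%E.
  under eq_integral do rewrite EFinB.
  rewrite integralB//; [|by apply: (iZ i.+1); rewrite leqnSn|by apply: (iZ i); rewrite leqnn ltnW].
  rewrite -[X in (X - _)%E]/(\int[P]_(z in E) (Z i.+1 z)%:E)%E eqj -(mi E FE) subee//.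
  by apply: integrable_fin_num => //; apply: (iZ i); rewrite leqnn ltnW.
have PnK : P (~` (K : set T)) = 0 by rewrite probability_setC// PK subee.
rewrite -[RHS]inc0 [RHS](@negligible_integral _ _ _ P E (~` (K : set T)))//.
- by rewrite setDE setCK.
- exact: measurableC.
- exact: integrable_increment.
Qed.

(* A countably-valued position: [q (idx z)] shares. *)
Lemma integral_transform i (E : set T) (idx : T -> nat) (q : nat -> R) (C : R) :
  (i < N)%N -> canonical_filtration i E ->
  (forall n, exists A : set T, canonical_filtration i A /\ forall z, K z -> A z <-> idx z = n) ->
  (forall z, K z -> `|q (idx z) * increment i z| <= C) ->
  P.-integrable (E `&` K) (fun z => (q (idx z) * increment i z)%:E) /\
  (\int[P]_(z in E `&` K) (q (idx z) * increment i z)%:E = 0)%E.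
Proof.
move=> iN FE adapted qC; have [A HA] := choice adapted; have mE := filtration_measurable FE.
have mA n : measurable (A n) := filtration_measurable (HA n).1.
pose Fn n := (E `&` A n) `&` (K : set T).
have mFn n : measurable (Fn n) by apply: measurableI => //; exact: measurableI.
have EK : E `&` K = \bigcup_n Fn n.
  apply/seteqP; split=> z.
    by move=> [Ez Kz]; exists (idx z) => //; split=> //; split=> //; apply/(HA (idx z)).2.
  by move=> [n _ [[Ez _] Kz]].
have tF : trivIset setT Fn.
  by move=> m n _ _ [z [[[_ Am] Kz] [[_ An] _]]]; rewrite -((HA m).2 z Kz).1// -((HA n).2 z Kz).1.
have minc : measurable_fun setT (increment i : T -> R).
  by apply: measurable_funB; exact: canonical_process_measurable.
have mq := measurable_countable_position q mE adapted.
(* Only the gain is bounded, not the position. *)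
have int : P.-integrable (E `&` K) (fun z => (q (idx z) * increment i z)%:E).
  apply: measurable_bounded_integrable => //.
  - exact: measurableI.
  - by apply: (le_lt_trans (probability_le1 _ _)); [exact: measurableI|rewrite ltry].
  - by apply: measurable_funM => //; exact: measurable_funTS.
  exists C; split; first exact: num_real.
  by move=> M CM z [_ Kz]; apply: le_trans (ltW CM); exact: qC.
split=> //; rewrite EK integral_bigcup//; last by rewrite -EK.
apply: eseries0 => n _ _.
rewrite (eq_integral (fun z : T => ((q n)%:E * (increment i z)%:E)%E)); last first.
  by move=> z /[!inE] -[[_ An] Kz]; rewrite ((HA n).2 z Kz).1.
rewrite integralZl//; last exact: integrable_increment.
by rewrite integral_increment ?mule0//; apply: filtrationI => //; exact: (HA n).1.
Qed.

End martingale_laws.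

(** * Value of the game option *)

Section strategy_selection.
Context {R : realType} {N : nat}.
Local Notation T := (borel_path R N).
Variables (s a b : R).
Hypotheses (s_gt0 : 0 < s) (a_ge0 : 0 <= a) (a_le_b : a <= b).
Let K : set (price_path R N) := admissible_paths s `[a, b]%classic.
Let mK : measurable (K : set T) := measurable_closed_path (closed_admissible_paths s_gt0 a_ge0).
Variables (k : nat) (kN : (k < N)%N) (U : price_path R N -> R).
Hypotheses (uscU : upper_semicontinuous_on K U) (U_ge0 : forall x, K x -> 0 <= U x).

Definition rational_position (n : nat) : R := ratr (odflt 0 (unpickle n : option rat)).

(* Taking the first good rational position avoids any measurable selection theorem. *)
Lemma measurable_near_optimal_position e : 0 < e -> exists idx : T -> nat,
  [/\ forall z, K z -> hedge_cost K k U (rational_position (idx z)) z < step_price K k U z + e,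
      forall u v, K u -> K v -> agree_upto k u v -> idx u = idx v &
      forall n, exists A : set T, canonical_filtration k A /\ forall z, K z -> A z <-> idx z = n].
Proof.
move=> e0; have [good goodE] : exists good : nat -> price_path R N -> bool, forall n z,
    good n z = (hedge_cost K k U (rational_position n) z < step_price K k U z + e).
  by exists (fun n z => hedge_cost K k U (rational_position n) z < step_price K k U z + e).
have good_agree n u v : agree_upto k u v -> good n u = good n v.
  by move=> uv; rewrite !goodE (hedge_cost_agree K _ _ uv) (step_price_agree _ _ uv).
have ex z : K z -> exists n, good n z.
  move=> Kz; have [q hq] := step_price_approx s_gt0 a_ge0 a_le_b kN uscU U_ge0 Kz e0.
  by exists (pickle q); rewrite goodE /rational_position pickleK.
have /choice[idx idxP] z : exists n, K z -> good n z /\ forall m, (m < n)%N -> ~~ good m z.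
  have [Kz|nKz] := pselect (K z); last by exists 0%N.
  case: (ex_minnP (ex z Kz)) => n gn nmin; exists n => _; split=> // m mn.
  by apply/negP => /nmin; rewrite leqNgt mn.
have idxE z n : K z -> idx z = n <-> good n z /\ forall m, (m < n)%N -> ~~ good m z.
  move=> Kz; split=> [<-|[gn nb]]; first exact: (idxP z Kz).
  have [gi ib] := idxP z Kz; apply/eqP; rewrite eqn_leq; apply/andP; split; rewrite leqNgt; apply/negP.
    by move=> /ib; rewrite gn.
  by move=> /nb; rewrite gi.
have idx_agree u v : K u -> K v -> agree_upto k u v -> idx u = idx v.
  move=> Ku Kv uv; apply/idxE => //; have [gv vb] := idxP v Kv.
  by split=> [|m /vb]; rewrite (good_agree _ _ _ uv).
exists idx; split=> // [z Kz|n]; first by rewrite -goodE; have [] := idxP z Kz.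
have mgood m : measurable ((K : set T) `&` [set z | good m z]).
  have mh : measurable_fun (K : set T) (hedge_cost K k U (rational_position m)).
    apply: usc_measurable => //; apply: usc_sup_cylinder.
      exact: compact_admissible_paths.
    exact: usc_hedge_cost_integrand.
  have ms : measurable_fun (K : set T) (fun z => step_price K k U z + e).
    by apply: measurable_funD => //; apply: usc_measurable => //; exact: usc_step_price.
  have := @measurable_fun_ltr _ _ _ _ _ _ mh ms mK [set true] Logic.I.
  by congr measurable; apply/seteqP; split=> z /=; rewrite goodE.
have mA : measurable ((K : set T) `&` [set z | idx z = n]).
  have -> : (K : set T) `&` [set z | idx z = n] =
      (K `&` [set z | good n z]) `\` \bigcup_(m in [set m | (m < n)%N]) (K `&` [set z | good m z]).
    apply/seteqP; split=> z /=.
      move=> [Kz /(idxE _ _ Kz)[gn nb]]; split=> // -[m /= mn [_ gm]].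
      by move: (nb m mn); rewrite gm.
    move=> [[Kz gn] nb]; split=> //; apply/idxE => //; split=> // m mn.
    by apply/negP => gm; apply: nb; exists m.
  by apply: measurableD => //; apply: bigcup_measurable.
(* The level sets of [idx] are Borel and nonanticipative on [K], hence traces of events known at
   time [k]. *)
have [|A [FA HA]] := filtration_restrict s_gt0 a_ge0 a_le_b (ltnW kN) mA.
  by move=> u v Ku Kv uv [_ /= un]; split=> //=; rewrite -(idx_agree u v).
by exists A; split=> // z Kz; rewrite HA//; split=> [[]|].
Qed.

(** As [U] is nonnegative, a capital of at most [M + e] covers the loss on [z] and on its flip. The
    latter loss is the gain on [z] times [Z k z / Z k.+1 z], a ratio of at least [expR (- b)]. *)
Lemma hedge_gain_bounded e : 0 <= e -> exists C, forall q z, K z ->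
  hedge_cost K k U q z <= step_price K k U z + e -> `|q * increment k z| <= C.
Proof.
move=> e0; have [M HM] := usc_bounded_above (compact_admissible_paths s_gt0 a_ge0 a_le_b)
  (usc_step_price s_gt0 a_ge0 a_le_b kN uscU U_ge0).
exists ((M + e) * expR b) => q z Kz hq.
have b1 : 1 <= expR b by rewrite -expR0 ler_expR (le_trans a_ge0).
have M0 : 0 <= M by exact: le_trans (step_price_ge0 s_gt0 a_ge0 a_le_b kN uscU U_ge0 Kz) (HM z Kz).
have hM := HM z Kz; have zz : cylinder K k z z by [].
have lo := le_hedge_cost s_gt0 a_ge0 a_le_b uscU q zz.
have zf := cylinder_flip s_gt0 a_ge0 kN zz.
have hi := le_hedge_cost s_gt0 a_ge0 a_le_b uscU q zf.
have U1 := U_ge0 Kz; have U2 := U_ge0 zf.1.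
rewrite (increment_flip kN Kz) in hi.
have zk := admissible_gt0 k Kz; have zk1 := admissible_gt0 k.+1 Kz.
have r_ge : 1 <= expR b * (Z k z / Z k.+1 z).
  rewrite mulrA ler_pdivlMr// mul1r.
  have /(admissible_pathsP _ _ s_gt0 a_ge0)[_ H] := Kz.
  have a1 : 1 <= expR a by rewrite -expR0 ler_expR.
  by case: (H k kN) => -[h1 h2]//; nra.
have r0 : 0 < Z k z / Z k.+1 z by rewrite divr_gt0.
move: (Z k z / Z k.+1 z) r_ge r0 hi => r r_ge r0 hi.
move: (increment k z) lo hi => d lo hi; rewrite ler_norml; apply/andP; split.
  have : - (q * d) <= M + e by lra.
  nra.
have : r * (q * d) <= M + e by lra.
move: (q * d) => t; have [t0|t0] := leP t 0; first by move=> _; nra.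
nra.
Qed.

End strategy_selection.

(** * Near-optimal hedges and near-optimal laws *)

Section game_value.
Context {R : realType} {N : nat}.
Local Notation T := (borel_path R N).
Variables (s a b : R).
Hypotheses (s_gt0 : 0 < s) (a_ge0 : 0 <= a) (a_le_b : a <= b).
Let K : set (price_path R N) := admissible_paths s `[a, b]%classic.
Let mK : measurable (K : set T) := measurable_closed_path (closed_admissible_paths s_gt0 a_ge0).
Variables F G : 'I_N.+1 -> price_path R N -> R.
Hypotheses (uscF : forall k, upper_semicontinuous_on K (F k))
  (uscG : forall k, upper_semicontinuous_on K (G k))
  (F_ge0 : forall k u, K u -> 0 <= F k u)
  (G_ge0 : forall k u, K u -> 0 <= G k u)
  (F_le_G : forall k u, K u -> F k u <= G k u)
  (naF : forall k : 'I_N.+1, nonanticipative_on K k (F k))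
  (naG : forall k : 'I_N.+1, nonanticipative_on K k (G k)).

Lemma exists_first_time (Q : nat -> price_path R N -> bool) :
  (forall k, measurable ((K : set T) `&` [set z | Q k z])) ->
  (forall k u v, (k < N)%N -> K u -> K v -> agree_upto k u v -> Q k u = Q k v) ->
  exists tau : T -> 'I_N.+1, stopping_times tau /\ is_first_time s a b (fun k z => Q k z) tau.
Proof.
move=> mQ nQ.
have /choice[C HC] k : exists C : set T,
    (k < N)%N -> canonical_filtration k C /\ forall z, K z -> C z <-> Q k z.
  have [kN|kN] := ltnP k N; last by exists set0.
  have [|C [FC CQ]] := filtration_restrict s_gt0 a_ge0 a_le_b (ltnW kN) (mQ k).
    by move=> u v Ku Kv uv [_ /= Qu]; split=> //=; rewrite -(nQ k u v).
  by exists C => _; split=> // z Kz; rewrite CQ//; split=> [[]|].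
exists (first_time C); split; first by apply: first_time_stopping => k /HC[].
move=> z Kz; split=> [tN|j jt Qj].
  by apply/(HC _ tN).2 => //; exact: first_time_hit.
apply: (first_time_before jt); apply/(HC j _).2 => //.
by rewrite (leq_trans jt)// -ltnS.
Qed.

(** Optional stopping: the stopped gain is a sum of one-step gains, the [i]-th restricted to the
    event, known at time [i], that neither player has stopped by then. *)
Lemma expected_payoff_le_hedge (P : probability T R) (sigma tau : T -> 'I_N.+1)
    (idx : 'I_N -> T -> nat) (q : nat -> R) (C : 'I_N -> R) x :
  martingale_laws K P -> stopping_times sigma -> stopping_times tau ->
  (forall (i : 'I_N) n, exists A : set T,
    canonical_filtration i A /\ forall z, K z -> A z <-> idx i z = n) ->
  (forall (i : 'I_N) z, K z -> `|q (idx i z) * increment i z| <= C i) ->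
  perfect_hedge K F G x (fun i z => q (idx i z)) sigma ->
  (expected_payoff K F G P sigma tau <= x%:E)%E.
Proof.
move=> PM ss st adapted bnd hedge.
pose E (i : 'I_N) : set T := [set z | (i < sigma z)%N /\ (i < tau z)%N].
have FE (i : 'I_N) : canonical_filtration i (E i).
  have iN : (i < N.+1)%N by rewrite ltnS ltnW.
  rewrite (_ : E i = ~` [set z | (sigma z <= Ordinal iN)%N] `&` ~` [set z | (tau z <= Ordinal iN)%N]).
    by apply: filtrationI; apply: filtrationC; [exact: (ss (Ordinal iN))|exact: (st (Ordinal iN))].
  by apply/seteqP; split=> z /= [/= h1 h2]; split; rewrite ?ltnNge; apply/negP; rewrite -?ltnNge.
have mE (i : 'I_N) : measurable (E i) := filtration_measurable (FE i).
pose h (i : 'I_N) : T -> \bar R := (fun z => (q (idx i z) * increment i z)%:E) \_ (E i).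
have hi (i : 'I_N) := integral_transform s_gt0 a_ge0 PM (ltn_ord i) (FE i) (adapted i) (bnd i).
have ih (i : 'I_N) : P.-integrable (K : set T) (h i).
  by apply/integrable_restrict => //; rewrite setIC; exact: (hi i).1.
have h0 (i : 'I_N) : (\int[P]_(z in (K : set T)) h i z = 0)%E.
  by rewrite -integral_mkcondr setIC (hi i).2.
have PK : P (K : set T) = 1%E by case: PM.
have ix : P.-integrable (K : set T) (cst x%:E).
  apply: finite_measure_integrable_cst => //.
pose V z := (x%:E + \sum_(i < N) h i z)%E.
have VE z : (portfolio_value x (fun i z => q (idx i z)) (minn (sigma z) (tau z)) z)%:E = V z.
  rewrite /portfolio_value /V EFinD -sumEFin; congr (_ + _)%E; rewrite big_mkcond /=.
  apply: eq_bigr => i _; rewrite /h patchE; case: ifPn => [|]; rewrite leq_min.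
    by move=> /andP[h1 h2]; rewrite mem_set.
  by move=> hn; rewrite memNset// => -[/= h1 h2]; rewrite h1 h2 in hn.
have iS : P.-integrable (K : set T) (fun z => \sum_(i < N) h i z)%E.
  exact: integrable_sum.
have iV : P.-integrable (K : set T) V by exact: integrableD.
have -> : x%:E = (\int[P]_(z in (K : set T)) V z)%E.
  have Ix : (\int[P]_(z in (K : set T)) cst x%:E z = x%:E)%E.
    by rewrite integral_cst// -[RHS]mule1; congr (_ * _)%E; exact: PK.
  by rewrite integralD// [X in (X + _)%E]Ix integral_sum// big1 ?adde0.
apply: ge0_le_integral => //.
- move=> z Kz; rewrite lee_fin /game_payoff addr_ge0// mulr_ge0 ?ler0n//; [exact: G_ge0|exact: F_ge0].
- apply/measurable_EFinP; exact: game_payoff_measurable.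
- exact: measurable_int iV.
- by move=> z Kz; rewrite -VE lee_fin; exact: hedge.
Qed.

(** A reference path: [U 0] is constant on [K], all paths of which start at [s]. *)
Let x0 : price_path R N := path_of (fun i => s * expR a ^+ i).
Let Kx0 : K x0 := admissible_nonempty s_gt0 a_ge0 a_le_b.
Let U := value s a b F G.

Let uscU k : upper_semicontinuous_on K (U k).
Proof. exact: usc_value. Qed.

Let U_ge0 k x : K x -> 0 <= U k x.
Proof. exact: value_ge0. Qed.

Let measurable_compare (f g : price_path R N -> R) : upper_semicontinuous_on K f ->
  upper_semicontinuous_on K g -> measurable ((K : set T) `&` [set z | f z <= g z]).
Proof.
move=> uf ug; have mf := usc_measurable mK uf; have mg := usc_measurable mK ug.
have := @measurable_fun_ler _ _ _ _ _ _ mf mg mK [set true] Logic.I.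
by congr measurable; apply/seteqP; split=> z.
Qed.

Lemma value_le_superreplication_price : ((U 0 x0)%:E <= superreplication_price K F G)%E.
Proof.
apply: le_ereal_inf_tmp => _ [x [g [sigma [tg [_ ns] hedge]]] <-]; rewrite lee_fin.
by apply: value_le_hedge hedge Kx0 => // i; case: (tg i).
Qed.

Lemma near_optimal_hedge e : 0 < e -> exists (sigma : T -> 'I_N.+1) x,
  [/\ stopping_times sigma, x <= U 0 x0 + e,
      exists g, [/\ trading_strategy K g, stopping_time_on K sigma & perfect_hedge K F G x g sigma] &
      forall P tau, martingale_laws K P -> stopping_times tau ->
        (expected_payoff K F G P sigma tau <= x%:E)%E].
Proof.
(* [N] steps at [d] each cost at most [e]; the divisor [N.+1] also covers [N = 0]. *)
move=> e0; pose d := e / N.+1%:R; have d0 : 0 < d by rewrite divr_gt0.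
have [|k u v kN Ku Kv uv|sigma [ss fs]] := @exists_first_time (fun k z => G (inord k) z <= U k z).
- by move=> k; exact: measurable_compare.
- have ik : (inord k : 'I_N.+1) = k :> nat by rewrite inordK// ltnS ltnW.
  rewrite (naG (k := inord k) Ku Kv) ?ik//; congr (_ <= _).
  exact: value_agree (ltnW kN) Ku Kv uv.
have /choice[idx idxP] (i : 'I_N) := measurable_near_optimal_position s_gt0 a_ge0 a_le_b
  (ltn_ord i) (@uscU i.+1) (@U_ge0 i.+1) d0.
have /choice[C bnd] (i : 'I_N) := hedge_gain_bounded s_gt0 a_ge0 a_le_b
  (ltn_ord i) (@uscU i.+1) (@U_ge0 i.+1) (ltW d0).
pose g (i : 'I_N) (z : price_path R N) : R := rational_position (idx i z).
have hedge : perfect_hedge K F G (U 0 x0 + d *+ N) g sigma.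
  apply: hedge_of_first_time => //; first exact: ltW.
  by move=> i z Kz; apply: ltW; have [h _ _] := idxP i; exact: h.
exists sigma, (U 0 x0 + d *+ N); split=> //.
- rewrite lerD2l /d -mulr_natr mulrAC ler_pdivrMr// ler_pM2l// ler_nat//.
- exists g; split=> //; last exact: stopping_times_on.
  move=> i; have [_ ia iA] := idxP i; split.
    rewrite -[K]setTI; exact: (measurable_countable_position s_gt0 a_ge0 _ measurableT iA).
  by move=> u v Ku Kv uv; rewrite /g (ia u v).
- move=> P tau PM st; apply: (expected_payoff_le_hedge PM ss st _ _ hedge) => [i n|i z Kz].
    by have [_ _] := idxP i; exact.
  by apply: bnd => //; apply: ltW; have [h _ _] := idxP i; exact: h.
Qed.

(** At time 0 no player can have stopped earlier, so [finite_martingale_value] applies to every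
    [sigma]. *)
Lemma near_optimal_law e : 0 < e -> exists P tau, [/\ martingale_laws K P, stopping_times tau &
  forall sigma, stopping_times sigma -> ((U 0 x0 - e)%:E <= expected_payoff K F G P sigma tau)%E].
Proof.
move=> e0.
have [|k u v kN Ku Kv uv|tau [st ft]] := @exists_first_time (fun k z => U k z <= F (inord k) z).
- by move=> k; exact: measurable_compare.
- have ik : (inord k : 'I_N.+1) = k :> nat by rewrite inordK// ltnS ltnW.
  rewrite (naF (k := inord k) Ku Kv) ?ik//; congr (_ <= _).
  exact: value_agree (ltnW kN) Ku Kv uv.
have [l [ml lU]] := finite_martingale_value s_gt0 a_ge0 a_le_b uscF uscG F_ge0 G_ge0 F_le_G naF naG
  ft (leq0n N) Kx0 e0.
exists (finite_law (l : seq (R * T))), tau; split=> //; first exact: (finite_martingale_law ml).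
move=> sigma ss; have [l0 l1 cl _] := ml.
rewrite /expected_payoff integral_finite_law//; last exact: game_payoff_measurable.
rewrite lee_fin; apply: (le_trans (lU sigma _ _)) => //.
  by move=> k u v _ _; exact: stopping_times_agree.
rewrite big_seq [leRHS]big_seq; apply: ler_sum => t tl.
by rewrite indicE mem_set ?mulr1//; have [] := cl t tl.
Qed.

End game_value.

Theorem theorem2p1 (R : realType) (N : nat) (s a b : R)
    (F G : 'I_N.+1 -> price_path R N -> R)
    (s_gt0 : 0 < s) (a_ge0 : 0 <= a) (a_le_b : a <= b) :
  let K : set (price_path R N) := admissible_paths s `[a, b]%classic in
  let T : set (borel_path R N -> 'I_N.+1) := stopping_times in
  let M : set (probability (borel_path R N) R) := martingale_laws K in
  let EH := expected_payoff K F G in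
  (forall k, upper_semicontinuous_on K (F k)) ->
  (forall k, upper_semicontinuous_on K (G k)) ->
  (forall k u, K u -> 0 <= F k u) ->
  (forall k u, K u -> 0 <= G k u) ->
  (forall k u, K u -> F k u <= G k u) ->
  (forall k : 'I_N.+1, nonanticipative_on K k (F k)) ->
  (forall k : 'I_N.+1, nonanticipative_on K k (G k)) ->
  [/\ superreplication_price K F G =
        ereal_inf [set ereal_sup [set ereal_sup [set EH P sigma tau
          | tau in T] | P in M] | sigma in T],
      ereal_inf [set ereal_sup [set ereal_sup [set EH P sigma tau
          | tau in T] | P in M] | sigma in T] =
        ereal_sup [set ereal_inf [set ereal_sup [set EH P sigma tau
          | tau in T] | sigma in T] | P in M] &
      ereal_sup [set ereal_inf [set ereal_sup [set EH P sigma tau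
          | tau in T] | sigma in T] | P in M] =
        ereal_sup [set ereal_sup [set ereal_inf [set EH P sigma tau
          | sigma in T] | tau in T] | P in M] ].
Proof.
move=> K T M EH uscF uscG F0 G0 FG naF naG.
pose x0 : price_path R N := path_of (fun i => s * expR a ^+ i).
set V := superreplication_price K F G; set A := ereal_inf _; set B := ereal_sup _.
set C := ereal_sup [set ereal_sup _ | P in M].
pose u := value s a b F G 0 x0.
have uV : (u%:E <= V)%E by exact: value_le_superreplication_price.
have Vu : (V <= u%:E)%E.
  apply/lee_addgt0Pr => e e0.
  have [sigma [x [_ xu hx _]]] := near_optimal_hedge s_gt0 a_ge0 a_le_b uscF uscG F0 G0 FG naF naG e0.
  apply: (@le_trans _ _ x%:E); last by rewrite -EFinD lee_fin.
  apply: ereal_inf_lbound; exists x => //.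
  by have [g hg] := hx; exists g, sigma.
have Au : (A <= u%:E)%E.
  apply/lee_addgt0Pr => e e0.
  have [sigma [x [ss xu _ hx]]] := near_optimal_hedge s_gt0 a_ge0 a_le_b uscF uscG F0 G0 FG naF naG e0.
  apply: (@le_trans _ _ x%:E); last by rewrite -EFinD lee_fin.
  apply: ge_ereal_inf; eexists; first by exists sigma.
  apply: ge_ereal_sup => _ [P PM <-]; apply: ge_ereal_sup => _ [tau st <-].
  exact: hx.
have uC : (u%:E <= C)%E.
  apply/lee_addgt0Pr => e e0.
  have [P [tau [PM st h]]] := near_optimal_law s_gt0 a_ge0 a_le_b uscF uscG F0 G0 FG naF naG e0.
  rewrite -leeBlDr// -EFinB; apply: le_ereal_sup_tmp; eexists; first by exists P.
  apply: le_ereal_sup_tmp; eexists; first by exists tau.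
  by apply: le_ereal_inf_tmp => _ [sigma ss <-]; exact: h.
(* [C <= B <= A] is the usual exchange of extrema; with [A <= u <= C] the chain closes. *)
have CB : (C <= B)%E.
  apply: ge_ereal_sup => _ [P PM <-]; apply: ge_ereal_sup => _ [tau st <-].
  apply: le_ereal_sup_tmp; eexists; first by exists P.
  apply: le_ereal_inf_tmp => _ [sigma ss <-].
  apply: le_ereal_sup_tmp; eexists; first by exists tau.
  by apply: ereal_inf_lbound; exists sigma.
have BA : (B <= A)%E.
  apply: le_ereal_inf_tmp => _ [sigma ss <-]; apply: ge_ereal_sup => _ [P PM <-].
  apply: le_ereal_sup_tmp; eexists; first by exists P.
  by apply: ereal_inf_lbound; exists sigma.
have CA := le_trans CB BA.
have Cu : C = u%:E by apply/eqP; rewrite eq_le uC (le_trans CA Au).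
split; apply/eqP; rewrite eq_le.
- by rewrite (le_trans Vu)// ?(le_trans Au uV)// -Cu.
- by rewrite BA (le_trans Au)// -Cu.
- by rewrite CB (le_trans BA)// (le_trans Au)// Cu.
Qed.
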